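(* Let $(A,S)$ be a QP on a quiver $Q$ with vertex set $Q_0$ and let $I$ be a subset of $Q_0$. Let $i\in I$ be such that $Q$ has no 2-cycles incident to $i$. Then the mutation $\mu_i(A|_I,S|_I)$ is right-equivalent to the restriction of $\mu_i(A,S)$ to $I$.
   Context: $K$ is a field. A quiver $Q$ is finite and loop-free, with vertex set $Q_0$, arrow set $Q_1$, head and tail maps $h,t$. Paths compose as functions: $a_1\cdots a_d$ is a path if $t(a_j)=h(a_{j+1})$; it is a cycle if $h(a_1)=t(a_d)$. $R=\bigoplus_{i\in Q_0}Ke_i$ is the vertex span, $A$ the arrow span (the $R$-bimodule with basis $Q_1$), $A^d$ the span of the paths of length $d$, $R\langle\langle A\rangle\rangle=\prod_{d\ge0}A^d$ the complete path algebra with the $\mathfrak m$-adic topology, where $\mathfrak m=\prod_{d\ge1}A^d$. A potential is an element of $R\langle\langle A\rangle\rangle$ all of whose terms are cycles of positive length. Two potentials $S,S'$ are cyclically equivalent if $S-S'$ lies in the closure of the span of all $a_1\cdots a_d-a_2\cdots a_da_1$ with $a_1\cdots a_d$ a cycle. A QP is a pair $(A,S)$ with $S$ a potential on $A$ such that no two different cycles appearing in $S$ are cyclically equivalent. QPs $(A,S)$, $(A',S')$ on the same vertex set are right-equivalent if there is an $R$-algebra isomorphism $\varphi:R\langle\langle A\rangle\rangle\to R\langle\langle A'\rangle\rangle$ (identity on $R$) with $\varphi(S)$ cyclically equivalent to $S'$. Direct sum: $(A,S)\oplus(A',S')=(A\oplus A',S+S')$. The cyclic derivative is $\partial_a(a_1\cdots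 a_d)=\sum_{s}\delta_{a,a_s}a_{s+1}\cdots a_da_1\cdots a_{s-1}$, extended linearly and continuously. A QP is trivial if $S\in A^2$ and $\{\partial_aS\mid a\in Q_1\}$ spans $A$; reduced if the degree-2 component of $S$ is $0$. By the Splitting Theorem of Derksen–Weyman–Zelevinsky every QP is right-equivalent to a direct sum of a trivial QP and a reduced QP, both unique up to right-equivalence; they are called its trivial part and its reduced part. Mutation: suppose $Q$ has no 2-cycle incident to the vertex $i$. An $i$-hook is a path $ab$ of length 2 with $t(a)=i=h(b)$. The premutation $\widetilde\mu_i(Q)$ is obtained by adding an arrow $[ab]:t(b)\to h(a)$ for every $i$-hook $ab$ and replacing every arrow $c$ incident to $i$ by an arrow $c^*$ in the opposite direction. Replace $S$ by a cyclically equivalent potential none of whose cycles begins at $i$; $[S]$ is obtained from it by replacing each factor $ab$ that is an $i$-hook by $[ab]$. Then $\widetilde\mu_i(A,S)=(\widetilde A,\widetilde S)$, where $\widetilde A$ is the arrow span of $\widetilde\mu_i(Q)$ and $\widetilde S=[S]+\sum b^*a^*[ab]$ (sum over all $i$-hooks $ab$). The mutation $\mu_i(A,S)$ is the reduced part of $\widetilde\mu_i(A,S)$ (well defined up to right-equivalence). Restriction: for $I\subseteq Q_0$, the restriction of $(A,S)$ to $I$ is the QP $(A|_I,S|_I)$ on the same vertex set $Q_0$, where $A|_I$ is the span of the arrows with both head and tail in $I$, and $S|_I=\psi_I(S)$, with $\psi_I:R\langle\langle A\rangle\rangle\to R\langle\langle A|_I\rangle\rangle$ the (continuous) $R$-algebra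 homomorphism that fixes every arrow in $A|_I$ and sends every other arrow to $0$. *)

(* Defs.v *)
(* Quivers with potentials over a field and their mutations. *)
From HB Require Import structures.
From mathcomp Require Import all_boot all_order all_algebra.
From mathcomp Require Import boolp classical_sets functions fsbigop.

Set Implicit Arguments.
Unset Strict Implicit.
Unset Printing Implicit Defensive.

Import GRing.Theory.
Local Open Scope ring_scope.

Record quiver (V : finType) := Quiver {
  arrow :> finType;
  hd : arrow -> V;
  tl : arrow -> V }.

Section Paths.
Variables (V : finType) (Q : quiver V).

Definition loop_free := forall a : Q, hd a != tl a.

Definition no_2cycle_at (i : V) :=
  forall a b : Q, tl a = hd b -> hd a = tl b -> (hd a != i) && (tl a != i).

(* The word [:: a1; ...; ad] read from the head v: h(a1) = v and
   t(a_j) = h(a_(j+1)). *)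
Fixpoint is_path (v : V) (w : seq Q) : bool :=
  if w is a :: w' then (hd a == v) && is_path (tl a) w' else true.

(* The head is part of the data, so that the paths of length 0 are the
   (v, [::]), one for each vertex v. *)
Record qpath := QPath {
  path_val : V * seq Q;
  path_valP : is_path path_val.1 path_val.2 }.

HB.instance Definition _ := [isSub for path_val].
HB.instance Definition _ := [Choice of qpath by <:].

Definition word_tail (v : V) (w : seq Q) : V := last v (map (@tl V Q) w).

Definition phead (p : qpath) : V := (val p).1.
Definition pword (p : qpath) : seq Q := (val p).2.
Definition ptail (p : qpath) : V := word_tail (phead p) (pword p).
Definition psize (p : qpath) : nat := size (pword p).

Definition is_cycle (p : qpath) : bool :=
  (0 < psize p)%N && (phead p == ptail p).

Lemma is_path_cat v w1 w2 :
  is_path v (w1 ++ w2) = is_path v w1 && is_path (word_tail v w1) w2.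
Proof. by elim: w1 v => //= a w1 IH v; rewrite IH andbA. Qed.

Fact take_subproof (k : nat) (p : qpath) :
  is_path (phead p) (take k (pword p)).
Proof.
have := path_valP p; rewrite -/(pword p) -/(phead p).
by rewrite -{1}(cat_take_drop k (pword p)) is_path_cat => /andP[].
Qed.

Fact drop_subproof (k : nat) (p : qpath) :
  is_path (word_tail (phead p) (take k (pword p))) (drop k (pword p)).
Proof.
have := path_valP p; rewrite -/(pword p) -/(phead p).
by rewrite -{1}(cat_take_drop k (pword p)) is_path_cat => /andP[].
Qed.

Definition ptake k p : qpath := @QPath (_, _) (take_subproof k p).
Definition pdrop k p : qpath := @QPath (_, _) (drop_subproof k p).

End Paths.

(* The complete path algebra: the product over all d of the span of the paths
   of length d is the set of all families of coefficients on paths. *)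
Definition cpalg (K : fieldType) (V : finType) (Q : quiver V) : Type :=
  qpath Q -> K.

HB.instance Definition _ (K : fieldType) (V : finType) (Q : quiver V) :=
  GRing.Lmodule.copy (cpalg K Q) (qpath Q -> K^o).

Section CPAlgRing.
Variables (K : fieldType) (V : finType) (Q : quiver V).
Implicit Types x y z : cpalg K Q.

Definition cpone : cpalg K Q := fun p => (psize p == 0%N)%:R.
Definition cpmul x y : cpalg K Q :=
  fun p => \sum_(k < (psize p).+1) x (ptake k p) * y (pdrop k p).

Let coef x (v : V) (w : seq Q) : K :=
  if insub (v, w) is Some q then x q else 0.

Let coefE x p : x p = coef x (phead p) (pword p).
Proof. by rewrite /coef -surjective_pairing valK. Qed.

Let cpmulE x y p : cpmul x y p = \sum_(0 <= k < (psize p).+1)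
  coef x (phead p) (take k (pword p)) *
  coef y (word_tail (phead p) (take k (pword p))) (drop k (pword p)).
Proof. by rewrite big_mkord; apply: eq_bigr => k _; rewrite !coefE. Qed.

Fact cpmulA : associative cpmul.
Proof.
move=> x y z; apply: funext => p; rewrite !cpmulE.
set v := phead p; set w := pword p; set n := psize p.
pose F l k := coef x v (take l w) *
  (coef y (word_tail v (take l w)) (drop l (take k w)) *
   coef z (word_tail v (take k w)) (drop k w)).
transitivity (\sum_(0 <= l < n.+1) \sum_(l <= k < n.+1) F l k).
  apply: eq_big_nat => l /andP[_]; rewrite ltnS => ln.
  rewrite -(coefE (cpmul y z) (pdrop l p)) cpmulE mulr_sumr.
  have -> : \sum_(l <= k < n.+1) F l k = \sum_(0 <= j < n.+1 - l) F l (j + l)%N.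
    by rewrite -{1}(add0n l) big_addn.
  rewrite /psize /pword /= size_drop -/(pword p) -/w.
  rewrite -subSn //; apply: eq_big_nat => j _; rewrite /F /phead /=.
  rewrite -/(phead p) -/v take_drop drop_drop; congr (_ * (_ * coef z _ _)).
  rewrite /word_tail -last_cat -map_cat.
  by rewrite -(@take_takel _ l (j + l)) ?leq_addl // cat_take_drop.
transitivity (\sum_(0 <= k < n.+1) \sum_(0 <= l < k.+1) F l k); last first.
  apply: eq_big_nat => k /andP[_]; rewrite ltnS => kn.
  rewrite -(coefE (cpmul x y) (ptake k p)) cpmulE mulr_suml.
  rewrite /psize /pword /= size_takel -/(pword p) -/w //.
  apply: eq_big_nat => l /andP[_]; rewrite ltnS => lk.
  by rewrite /F /phead /= take_takel // mulrA.
under eq_bigr => l _ do rewrite (big_nat_widenl _ 0) //=.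
rewrite (exchange_big_dep xpredT) //=; apply: eq_big_nat => k /andP[_ kn].
by rewrite [RHS](big_nat_widen _ _ n.+1).
Qed.

Fact cpmul1l : left_id cpone cpmul.
Proof.
move=> x; apply: funext => p; rewrite /cpmul big_ord_recl big1 ?addr0 => [|k _].
  rewrite /cpone /psize /pword /= take0 mul1r.
  by congr x; apply: val_inj; rewrite /= take0 drop0 -surjective_pairing.
rewrite /cpone /psize /pword /= size_takel ?mul0r //; exact: ltn_ord.
Qed.

Fact cpmul1r : right_id cpone cpmul.
Proof.
move=> x; apply: funext => p; rewrite /cpmul big_ord_recr /= big1 ?add0r => [|k _].
  rewrite /cpone /psize /pword /= drop_size mulr1.
  by congr x; apply: val_inj; rewrite /= take_size -surjective_pairing.
by rewrite /cpone /psize /pword /= size_drop subn_eq0 leqNgt ltn_ord mulr0.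
Qed.

Fact cpmulDl : left_distributive cpmul +%R.
Proof.
move=> x y z; apply: funext => p.
have addE (u1 u2 : cpalg K Q) q : (u1 + u2) q = u1 q + u2 q by [].
by rewrite addE /cpmul -big_split; apply: eq_bigr => k _; rewrite addE mulrDl.
Qed.

Fact cpmulDr : right_distributive cpmul +%R.
Proof.
move=> x y z; apply: funext => p.
have addE (u1 u2 : cpalg K Q) q : (u1 + u2) q = u1 q + u2 q by [].
by rewrite addE /cpmul -big_split; apply: eq_bigr => k _; rewrite addE mulrDr.
Qed.

(* Not a nzRingType: the algebra is 0 when there is no vertex. *)
HB.instance Definition _ := GRing.Zmodule_isPzRing.Build (cpalg K Q)
  cpmulA cpmul1l cpmul1r cpmulDl cpmulDr.

End CPAlgRing.

Section CPAlg.
Variables (K : fieldType) (V : finType) (Q : quiver V).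
Local Notation RA := (cpalg K Q).

Definition vert (v : V) : RA := fun p => (val p == (v, [::]))%:R.
Definition arr (a : Q) : RA := fun p => (val p == (hd a, [:: a]))%:R.

(* For a nonempty word this is the corresponding path, or 0 if the letters are
   not composable. *)
Definition word (w : seq Q) : RA := \prod_(a <- w) arr a.

Definition lin_span (G : set RA) : set RA :=
  [set x | exists (n : nat) (c : 'I_n -> K) (g : 'I_n -> RA),
     (forall k, G (g k)) /\ x = \sum_(k < n) c k *: g k].

(* A coset x + m^d consists of the y with the same coefficients as x on the
   paths of length < d. *)
Definition madic_closure (U : set RA) : set RA :=
  [set x | forall d : nat, exists2 u, U u &
     forall p : qpath Q, (psize p < d)%N -> x p = u p].

Definition potential (S : RA) := forall p, S p != 0 -> is_cycle p.

Definition rotation_gens : set RA :=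
  [set x | exists2 p : qpath Q, is_cycle p &
     x = word (pword p) - word (rot 1 (pword p))].

Definition cyc_equiv (S S' : RA) :=
  madic_closure (lin_span rotation_gens) (S - S').

End CPAlg.

Arguments vert {K V} Q v.
Arguments arr {K V Q} a.
Arguments word {K V Q} w.

Section Extension.
Variables (K : fieldType) (V : finType) (Q Q' : quiver V).

(* The continuous linear map sending each path p to f p. The sum giving a
   coefficient is finite in all the uses below. *)
Definition path_ext (f : qpath Q -> cpalg K Q') (x : cpalg K Q) : cpalg K Q' :=
  fun q => \sum_(p \in [set: qpath Q]) x p * f p q.

(* The continuous R-algebra homomorphism sending each arrow a to g a, for g a
   a combination of paths of positive length from tl a to hd a. *)
Definition alg_ext (g : Q -> cpalg K Q') : cpalg K Q -> cpalg K Q' :=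
  path_ext (fun p => vert Q' (phead p) * \prod_(a <- pword p) g a).

End Extension.

Section CyclicDerivative.
Variables (K : fieldType) (V : finType) (Q : quiver V).

(* With 0-based positions, w = a_1 ... a_s a a_(s+2) ... a_d contributes
   a_(s+2) ... a_d a_1 ... a_s. *)
Definition cyc_deriv_word (a : Q) (w : seq Q) : cpalg K Q :=
  \sum_(s < size w | onth w s == Some a) word (drop s.+1 w ++ take s w).

Definition cyc_deriv (a : Q) : cpalg K Q -> cpalg K Q :=
  path_ext (fun p => if is_cycle p then cyc_deriv_word a (pword p) else 0).

End CyclicDerivative.

(* A quiver with an element of its complete path algebra; the conditions that
   make it a QP are in is_qp. *)
Record qpair (K : fieldType) (V : finType) := QPair {
  qquiver : quiver V;
  qpot : cpalg K qquiver }.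

Arguments qpot {K V} q.

Section QP.
Variables (K : fieldType) (V : finType).
Implicit Types P M T : qpair K V.

Definition is_qp P :=
  [/\ loop_free (qquiver P), potential (qpot P) &
      forall p q, qpot P p != 0 -> qpot P q != 0 -> p <> q ->
        ~ cyc_equiv (K := K) (word (pword p)) (word (pword q))].

(* Being the identity on R makes the ring morphism phi K-linear. *)
Definition right_equiv P P' :=
  exists phi : {rmorphism cpalg K (qquiver P) -> cpalg K (qquiver P')},
    [/\ bijective phi,
        forall (c : K) (v : V),
          phi (c *: vert (qquiver P) v) = c *: vert (qquiver P') v &
        cyc_equiv (phi (qpot P)) (qpot P')].

Definition sum_quiver (Q Q' : quiver V) : quiver V :=
  @Quiver V (Q + Q')%type
    (fun a => match a with inl b => hd b | inr b => hd b end)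
    (fun a => match a with inl b => tl b | inr b => tl b end).

Definition direct_sum P P' : qpair K V :=
  @QPair K V (sum_quiver (qquiver P) (qquiver P'))
    (alg_ext (fun a => arr (Q := sum_quiver _ _) (inl a)) (qpot P) +
     alg_ext (fun a => arr (Q := sum_quiver _ _) (inr a)) (qpot P')).

Definition trivial_qp P :=
  (forall p, qpot P p != 0 -> psize p = 2%N) /\
  lin_span (range (fun a : qquiver P => cyc_deriv a (qpot P))) =
  lin_span (range (fun a : qquiver P => arr a)).

Definition reduced_qp P := forall p, psize p = 2%N -> qpot P p = 0.

Definition is_reduced_part P M :=
  [/\ is_qp M, reduced_qp M &
      exists T, [/\ is_qp T, trivial_qp T & right_equiv P (direct_sum T M)]].

End QP.

Section Restriction.
Variables (K : fieldType) (V : finType) (I : {set V}).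

Definition restrict_quiver (Q : quiver V) : quiver V :=
  @Quiver V {a : Q | (hd a \in I) && (tl a \in I)}
    (fun a => hd (val a)) (fun a => tl (val a)).

Definition restrict_arr (Q : quiver V) (a : Q) : cpalg K (restrict_quiver Q) :=
  if insub a is Some b then arr (Q := restrict_quiver Q) b else 0.

Definition restriction (P : qpair K V) : qpair K V :=
  QPair (alg_ext (@restrict_arr (qquiver P)) (qpot P)).

End Restriction.

Section Mutation.
Variables (K : fieldType) (V : finType) (i : V).

Definition hook (Q : quiver V) : finType :=
  {ab : Q * Q | (tl ab.1 == i) && (hd ab.2 == i)}.

(* inr w is the arrow [ab] for the hook w = (a, b); inl c is c if c is not
   incident to i, and c^* if it is. *)
Definition premut_quiver (Q : quiver V) : quiver V :=
  let incident (c : Q) := (hd c == i) || (tl c == i) in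
  @Quiver V (Q + hook Q)%type
    (fun x => match x with
              | inl c => if incident c then tl c else hd c
              | inr w => hd (val w).1
              end)
    (fun x => match x with
              | inl c => if incident c then hd c else tl c
              | inr w => tl (val w).2
              end).

(* Without loops at i two i-hooks in a path cannot overlap, so scanning from
   the left replaces all of them. *)
Fixpoint bracket_word (Q : quiver V) (w : seq Q) : seq (premut_quiver Q) :=
  match w with
  | a :: w1 =>
    match w1 with
    | b :: w2 =>
      if insub (a, b) is Some ab
      then (inr ab : premut_quiver Q) :: bracket_word w2
      else (inl a : premut_quiver Q) :: bracket_word w1
    | [::] => [:: inl a : premut_quiver Q]
    end
  | [::] => [::]
  end.

Definition bracket (Q : quiver V) : cpalg K Q -> cpalg K (premut_quiver Q) :=
  path_ext (fun p => vert (premut_quiver Q) (phead p) *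
                     word (bracket_word (pword p))).

(* To be applied to a potential with no cycle beginning at i. *)
Definition premutation (P : qpair K V) : qpair K V :=
  let Qt := premut_quiver (qquiver P) in
  @QPair K V Qt
    (bracket (qpot P) +
     \sum_(w : hook (qquiver P))
       word [:: (inl (val w).2 : Qt); (inl (val w).1 : Qt); (inr w : Qt)]).

(* M is a mutation of P at i, which is only determined up to
   right-equivalence. *)
Definition is_mutation (P M : qpair K V) :=
  exists S : cpalg K (qquiver P),
    [/\ potential S, cyc_equiv (qpot P) S,
        forall p, S p != 0 -> phead p != i &
        is_reduced_part (premutation (QPair S)) M].

End Mutation.

(* Main.v *)
From HB Require Import structures.
From mathcomp Require Import all_boot all_algebra.
From mathcomp Require Import boolp classical_sets fsbigop finmap.
Require Import Defs.

(* Restriction sends right-equivalences to right-equivalences and commutes with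
   direct sums and, when i lies in I, with premutation up to cyclic equivalence,
   so the statement amounts to the uniqueness of the reduced part of a QP.

   Let f be a right-equivalence from C + A to C' + A', with C and C' trivial.
   Each 2-cycle of a trivial potential consists of a forward and a backward
   arrow for a total order on the vertices.  Geometrically, let X be the subspace
   where the forward arrows of C and the images of the backward arrows of C'
   vanish.  Both trivial potentials vanish on X, so the two reduced potentials
   agree there.  By nondegeneracy of the quadratic parts the linear part of f
   identifies the spans of C and C', so by the inverse function theorem X is
   coordinatized by A as well as by A'; the change of coordinates is the
   right-equivalence wanted. *)

Set Implicit Arguments.
Unset Strict Implicit.
Unset Printing Implicit Defensive.

Import GRing.Theory.
Local Open Scope ring_scope.

(** The equations of X run in opposite directions on the two sides for a reason. The linear part of
    a homomorphism over R joins parallel arrows only, so forward and backward arrows do not mix.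
    Hence the linear parts of the forward arrows of C and of the images of the backward arrows of C'
    together form a basis of the span of C, and the equations of X are independent. With forward
    arrows on both sides the linear parts would span the same space while the terms of higher order
    could differ. On X every monomial of either trivial potential has a vanishing factor, whichever
    direction was chosen. So both vanish there exactly, not merely up to cyclic equivalence, which
    enters only through f. Nondegeneracy concerns the symmetrized matrix t + t^T: cyclic equivalence
    shifts coefficients between the two rotations of a 2-cycle and fixes only their sum. No division
    by 2 occurs, so every characteristic is covered at once. *)

Section Coefficients.
Variables (K : fieldType) (V : finType) (Q : quiver V).
Local Notation RA := (cpalg K Q).
Implicit Types (x y z : RA) (v : V) (w : seq Q).

(** Total in the word, with value 0 on words that are not composable, so that identities can be
    proved by induction on words without carrying path proofs. *)
Definition coef x v w : K := if insub (v, w) is Some q then x q else 0.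

Lemma coefE x p : x p = coef x (phead p) (pword p).
Proof. by rewrite /coef -surjective_pairing valK. Qed.

Lemma coef_path x v w (pf : is_path v w) :
  coef x v w = x (@QPath V Q (v, w) pf).
Proof. by rewrite coefE. Qed.

Lemma coef_npath x v w : ~~ is_path v w -> coef x v w = 0.
Proof. by move=> h; rewrite /coef insubF //; apply: negbTE. Qed.

Lemma coef_ext x y :
  (forall v w, is_path v w -> coef x v w = coef y v w) -> x = y.
Proof.
by move=> h; apply: funext => p; rewrite !coefE h //; exact: path_valP.
Qed.

Lemma coef0 v w : coef 0 v w = 0.
Proof. by rewrite /coef; case: insub. Qed.

Lemma coefD x y v w : coef (x + y) v w = coef x v w + coef y v w.
Proof. by rewrite /coef; case: insub => [q|]; rewrite ?addr0. Qed.

Lemma coefZ c x v w : coef (c *: x) v w = c * coef x v w.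
Proof. by rewrite /coef; case: insub => [q|]; rewrite ?mulr0. Qed.

Lemma coefN x v w : coef (- x) v w = - coef x v w.
Proof. by rewrite /coef; case: insub => [q|]; rewrite ?oppr0. Qed.

Lemma coefB x y v w : coef (x - y) v w = coef x v w - coef y v w.
Proof. by rewrite coefD coefN. Qed.

Lemma coef_sum (J : Type) (s : seq J) (P : pred J) (F : J -> RA) v w :
  coef (\sum_(j <- s | P j) F j) v w = \sum_(j <- s | P j) coef (F j) v w.
Proof.
elim/big_rec2: _ => [|j a b _ <-]; [exact: coef0|exact: coefD].
Qed.

Lemma coefM x y v w : coef (x * y) v w = \sum_(0 <= k < (size w).+1)
  coef x v (take k w) * coef y (word_tail v (take k w)) (drop k w).
Proof.
have [pf|npf] := boolP (is_path v w); last first.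
  rewrite coef_npath // big1_seq // => k _.
  move: npf; rewrite -{1}(cat_take_drop k w) is_path_cat negb_and.
  by case/orP => h; rewrite (coef_npath _ h) ?mul0r ?mulr0.
rewrite coef_path big_mkord; apply: eq_bigr => k _.
by rewrite !coefE.
Qed.

Lemma coef_vert u v w : coef (vert Q u) v w = ((v, w) == (u, [::]))%:R.
Proof.
have [pf|npf] := boolP (is_path v w); first by rewrite coef_path.
rewrite coef_npath //; case: eqP => [[e1 e2]|//].
by rewrite e2 in npf.
Qed.

Lemma coef_arr (a : Q) v w :
  coef (arr a : RA) v w = ((v, w) == (hd a, [:: a]))%:R.
Proof.
have [pf|npf] := boolP (is_path v w); first by rewrite coef_path.
rewrite coef_npath //; case: eqP => [[e1 e2]|//].
by rewrite e1 e2 /= eqxx in npf.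
Qed.

Lemma coef_one v w : coef (1 : RA) v w = (w == [::])%:R.
Proof.
have [pf|npf] := boolP (is_path v w).
  by rewrite coef_path; case: w pf.
by rewrite coef_npath //; case: w npf.
Qed.

Lemma word_tail_cat v w1 w2 :
  word_tail v (w1 ++ w2) = word_tail (word_tail v w1) w2.
Proof. by rewrite /word_tail map_cat last_cat. Qed.

Lemma coef_vertM u x v w : coef (vert Q u * x) v w = (v == u)%:R * coef x v w.
Proof.
rewrite coefM big_nat_recl // big1_seq ?addr0 => [|k].
  by rewrite take0 drop0 coef_vert xpair_eqE eqxx andbT.
rewrite mem_index_iota => /andP[_ /andP[_ kw]].
rewrite coef_vert xpair_eqE; case: w kw => // a w _ /=.
by rewrite andbF mul0r.
Qed.

Lemma coef_Mvert u x v w :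
  coef (x * vert Q u) v w = (word_tail v w == u)%:R * coef x v w.
Proof.
rewrite coefM big_nat_recr //= big1_seq ?add0r => [|k].
  by rewrite take_size drop_size coef_vert xpair_eqE eqxx andbT mulrC.
rewrite mem_index_iota => /andP[_ /andP[_ kw]].
rewrite coef_vert xpair_eqE -size_eq0 size_drop subn_eq0 leqNgt kw /=.
by rewrite andbF mulr0.
Qed.

Lemma coef_arrM (a : Q) x v w : coef (arr a * x) v w =
  if w is b :: w' then ((v == hd a) && (b == a))%:R * coef x (tl a) w' else 0.
Proof.
case: w => [|b w].
  by rewrite coefM big_nat1 coef_arr xpair_eqE andbF mul0r.
rewrite coefM big_nat_recl // coef_arr xpair_eqE andbF mul0r add0r.
rewrite big_nat_recl //= take0 drop0 big1_seq ?addr0 => [|k].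
  rewrite coef_arr xpair_eqE eqseq_cons eqxx andbT.
  by case: (b =P a) => [->|_]; rewrite // !andbF !mul0r.
rewrite mem_index_iota => /andP[_ /andP[_ kw]].
rewrite coef_arr xpair_eqE eqseq_cons; case: w kw => // c w _ /=.
by rewrite !andbF mul0r.
Qed.

Lemma scalerAlc c x y : (c *: x) * y = c *: (x * y).
Proof.
apply: coef_ext => v w _; rewrite coefZ !coefM mulr_sumr.
by apply: eq_bigr => k _; rewrite coefZ mulrA.
Qed.

Lemma scalerArc c x y : x * (c *: y) = c *: (x * y).
Proof.
apply: coef_ext => v w _; rewrite coefZ !coefM mulr_sumr.
by apply: eq_bigr => k _; rewrite coefZ mulrCA.
Qed.

Lemma one_vert : 1 = \sum_v vert Q v :> RA.
Proof.
apply: coef_ext => v w _; rewrite coef_one coef_sum (bigD1 v) //= big1 ?addr0.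
  by rewrite coef_vert xpair_eqE eqxx.
by move=> u uv; rewrite coef_vert xpair_eqE eq_sym (negbTE uv).
Qed.

Lemma vertM u v : vert Q u * vert Q v = (u == v)%:R *: vert Q v :> RA.
Proof.
apply: coef_ext => v' w _; rewrite coef_vertM coefZ !coef_vert xpair_eqE.
case: (eqVneq v' v) => [->|_] /=; last by rewrite !mulr0.
by rewrite eq_sym.
Qed.

Lemma vert_idem v : vert Q v * vert Q v = vert Q v :> RA.
Proof. by rewrite vertM eqxx scale1r. Qed.

Lemma vertM_neq u v : u != v -> vert Q u * vert Q v = 0 :> RA.
Proof. by rewrite vertM => /negbTE ->; rewrite scale0r. Qed.

Lemma vert_arr (a : Q) : vert Q (hd a) * arr a = arr a :> RA.
Proof.
apply: coef_ext => v w _; rewrite coef_vertM coef_arr xpair_eqE.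
by case: eqP; rewrite /= ?mulr0 ?mul1r.
Qed.

Lemma arr_vert (a : Q) : arr a * vert Q (tl a) = arr a :> RA.
Proof.
apply: coef_ext => v w _; rewrite coef_Mvert coef_arr.
case: ((v, w) =P _) => [[-> ->]|_]; rewrite ?mulr0 //.
by rewrite /word_tail /= eqxx mulr1.
Qed.

(** The basis element of the path with head v and word w, or 0 if there is none. The factor
    [vert Q v] is what makes trivial paths available: [word [::]] alone is 1, the sum of all
    vertices. *)
Definition pbase v w : RA := vert Q v * word w.

Lemma word_nil : word [::] = 1 :> RA. Proof. exact: big_nil. Qed.
Lemma word_cons a w : word (a :: w) = arr a * word w :> RA.
Proof. exact: big_cons. Qed.
Lemma word_cat w1 w2 : word (w1 ++ w2) = word w1 * word w2 :> RA.
Proof. exact: big_cat. Qed.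
Lemma word1 a : word [:: a] = arr a :> RA.
Proof. exact: big_seq1. Qed.

Lemma coef_pbase v w v' w' :
  coef (pbase v w) v' w' = (is_path v w && ((v', w') == (v, w)))%:R.
Proof.
rewrite /pbase coef_vertM.
elim: w v v' w' => [v v' w'|a w IH v v' w'].
  by rewrite word_nil coef_one xpair_eqE -natrM mulnb.
rewrite word_cons coef_arrM /=; case: w' => [|b w'].
  by rewrite xpair_eqE !andbF mulr0.
rewrite xpair_eqE eqseq_cons; case: (eqVneq v' v) => [->|_]; rewrite ?mul0r ?andbF //= mul1r.
have := IH (tl a) (tl a) w'; rewrite eqxx mul1r => ->.
rewrite xpair_eqE eqxx /= [v == _]eq_sym -natrM mulnb; congr ((nat_of_bool _)%:R).
by case: (hd a == v); case: (b == a); case: is_path.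
Qed.

Lemma pbase_npath v w : ~~ is_path v w -> pbase v w = 0.
Proof.
move=> h; apply: coef_ext => v' w' _.
by rewrite coef_pbase (negbTE h) coef0.
Qed.

Lemma pbaseM v w v' w' :
  pbase v w * pbase v' w' = (word_tail v w == v')%:R *: pbase v (w ++ w').
Proof.
apply: coef_ext => u w1 _.
rewrite coefZ /pbase mulrA word_cat mulrA.
elim: w v u w1 => [|a w IH] v u w1.
  rewrite word_nil !mulr1 vertM scalerAlc coefZ /word_tail /=.
  by case: eqP => [->|]; rewrite ?mul0r.
rewrite word_cons -!mulrA !coef_vertM !coef_arrM.
case: w1 => [|b w1]; first by rewrite !mulr0.
rewrite [word_tail v _](_ : _ = word_tail (tl a) w) //.
have := IH (tl a) (tl a) w1.
rewrite -!mulrA !coef_vertM eqxx !mul1r => ->.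
by rewrite !mulrA; congr (_ * _); rewrite mulrC mulrA.
Qed.

End Coefficients.

(** * The m-adic filtration *)

Section Filtration.
Variables (K : fieldType) (V : finType) (Q : quiver V).
Local Notation RA := (cpalg K Q).
Implicit Types (x y z : RA) (v : V) (w : seq Q).

(* The ideal m^d. *)
Definition mpow d x := forall v w, (size w < d)%N -> coef x v w = 0.

Lemma mpow0 x : mpow 0 x. Proof. by []. Qed.
Lemma mpow_0 d : mpow d 0. Proof. by move=> v w _; rewrite coef0. Qed.
Lemma mpowD d x y : mpow d x -> mpow d y -> mpow d (x + y).
Proof. by move=> hx hy v w hw; rewrite coefD hx // hy // addr0. Qed.
Lemma mpowN d x : mpow d x -> mpow d (- x).
Proof. by move=> hx v w hw; rewrite coefN hx // oppr0. Qed.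
Lemma mpowB d x y : mpow d x -> mpow d y -> mpow d (x - y).
Proof. by move=> hx hy; apply/mpowD/mpowN. Qed.
Lemma mpowZ d c x : mpow d x -> mpow d (c *: x).
Proof. by move=> hx v w hw; rewrite coefZ hx // mulr0. Qed.
Lemma mpow_sum d (J : Type) (s : seq J) (P : pred J) (F : J -> RA) :
  (forall j, P j -> mpow d (F j)) -> mpow d (\sum_(j <- s | P j) F j).
Proof.
by move=> h; apply: big_ind => //; [exact: mpow_0|exact: mpowD].
Qed.
Lemma mpowW d d' x : (d' <= d)%N -> mpow d x -> mpow d' x.
Proof. by move=> h hx v w hw; apply: hx; exact: leq_trans hw h. Qed.
Lemma mpowM d d' x y : mpow d x -> mpow d' y -> mpow (d + d') (x * y).
Proof.
move=> hx hy v w hw; rewrite coefM big1_seq // => k.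
rewrite mem_index_iota ltnS => /andP[_ /andP[_ kw]].
have [kd|dk] := ltnP k d; first by rewrite hx ?mul0r // size_takel.
rewrite hy ?mulr0 // size_drop ltn_subLR //.
by apply: leq_trans hw _; rewrite leq_add2r.
Qed.
Lemma mpowMl d x y : mpow d x -> mpow d (x * y).
Proof. by move=> hx; rewrite -[d]addn0; apply: mpowM. Qed.
Lemma mpowMr d x y : mpow d y -> mpow d (x * y).
Proof. by move=> hx; rewrite -[d]add0n; apply: mpowM. Qed.
Lemma mpow_arr (a : Q) : mpow 1 (arr a : RA).
Proof. by move=> v [|b w] //; rewrite coef_arr xpair_eqE andbF. Qed.
Lemma mpow_word w : mpow (size w) (word w : RA).
Proof.
elim: w => [|a w IH]; first exact: mpow0.
by rewrite word_cons -[size _]add1n; apply: mpowM => //; exact: mpow_arr.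
Qed.
Lemma mpow_eq0 x : (forall d, mpow d x) -> x = 0.
Proof.
by move=> h; apply: coef_ext => v w _; rewrite coef0 (h (size w).+1).
Qed.

Lemma mpow_eq x y : (forall d, mpow d (x - y)) -> x = y.
Proof. by move=> h; apply/eqP; rewrite -subr_eq0; apply/eqP/mpow_eq0. Qed.

(** Left division by a. The last factor matters for trivial paths p only; for longer ones
    composability of [a :: pword p] already forces the head of p to be the tail of a. *)
Definition ldiv (a : Q) x : RA := fun p => coef x (hd a) (a :: pword p) *
  (phead p == tl a)%:R.

Lemma coef_ldiv a x v w : coef (ldiv a x) v w =
  (v == tl a)%:R * coef x (hd a) (a :: w).
Proof.
have [pf|npf] := boolP (is_path v w); first by rewrite coef_path mulrC.
rewrite coef_npath //; case: eqP npf => [->|_ _]; rewrite ?mul0r //.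
by move=> npf; rewrite coef_npath ?mulr0 //= eqxx.
Qed.

Lemma mpow_ldiv d a x : mpow d.+1 x -> mpow d (ldiv a x).
Proof. by move=> hx v w hw; rewrite coef_ldiv hx ?mulr0. Qed.

(** The sums are finite, so every ring morphism respects this decomposition, continuous or not.
    Automatic continuity rests on it. *)
Lemma decomp x : x = \sum_v coef x v [::] *: vert Q v +
  \sum_a arr a * ldiv a x.
Proof.
apply: coef_ext => v [|a w] /= pf; rewrite coefD !coef_sum.
  rewrite [X in _ + X]big1 ?addr0 => [|a _]; last by rewrite coef_arrM.
  rewrite (bigD1 v) //= big1 ?addr0; first by rewrite coefZ coef_vert eqxx mulr1.
  by move=> u uv; rewrite coefZ coef_vert xpair_eqE eq_sym (negbTE uv) mulr0.
rewrite big1 ?add0r => [|u _]; last first.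
  by rewrite coefZ coef_vert xpair_eqE andbF mulr0.
case/andP: pf => /eqP <- pf.
rewrite (bigD1 a) //= big1 ?addr0 => [|b ba].
  by rewrite coef_arrM !eqxx coef_ldiv eqxx !mul1r.
by rewrite coef_arrM (eq_sym a) (negbTE ba) andbF mul0r.
Qed.

Lemma decomp1 x : mpow 1 x -> x = \sum_a arr a * ldiv a x.
Proof.
move=> hx; rewrite {1}(decomp x) big1 ?add0r // => v _.
by rewrite hx // scale0r.
Qed.

End Filtration.

(** * Continuous linear maps and vertex-preserving homomorphisms *)

Section Truncation.
Variables (K : fieldType) (V : finType) (Q : quiver V).
Local Notation RA := (cpalg K Q).
Implicit Types (x y : RA) (v : V) (w : seq Q) (d : nat).

Definition paths_le d : seq (qpath Q) :=
  undup (pmap insub [seq (v, val t) | v <- enum V, t <- enum {: d.-bseq Q}]).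

Lemma mem_paths_le d p : (p \in paths_le d) = (psize p <= d)%N.
Proof.
rewrite mem_undup mem_pmap_sub; apply/allpairsP/idP.
  by case=> [[v w] [_ _ e]]; rewrite /psize /pword e /= size_bseq.
move=> h; exists (phead p, Bseq h); split; rewrite ?mem_enum //=.
exact: surjective_pairing.
Qed.

Definition trunc d x : RA :=
  \sum_(p <- paths_le d) x p *: pbase K (phead p) (pword p).

Lemma pbaseE (p q : qpath Q) : pbase K (phead p) (pword p) q = (q == p)%:R.
Proof.
rewrite coefE coef_pbase (path_valP p) /= -(inj_eq val_inj q p).
by rewrite /phead /pword -!surjective_pairing.
Qed.

Lemma sum_pbaseE d (F : qpath Q -> K) q :
  \sum_(p <- paths_le d) F p * (q == p)%:R = if (psize q <= d)%N then F q else 0.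
Proof.
rewrite -mem_paths_le; case: ifPn => h.
  rewrite (bigD1_seq q) ?undup_uniq //= eqxx mulr1 big1 ?addr0 // => p.
  by rewrite eq_sym => /negbTE ->; rewrite mulr0.
rewrite big1_seq // => p /= pin; case: eqP => [e|_]; last by rewrite mulr0.
by rewrite e pin in h.
Qed.

Lemma mpow_trunc (d : nat) (x : RA) : mpow d.+1 (x - trunc d x).
Proof.
move=> v w hw; have [pf|npf] := boolP (is_path v w); last by rewrite coef_npath.
pose q := @QPath V Q (v, w) pf.
rewrite coefB coef_sum coef_path -/q.
rewrite (eq_bigr (fun p => x p * (q == p)%:R)) => [|p _].
  by rewrite sum_pbaseE ifT ?subrr.
by rewrite coefZ -pbaseE (coefE _ q).
Qed.

End Truncation.

Section LinearContinuous.
Variables (K : fieldType) (V : finType) (Q Q' : quiver V).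
Local Notation RA := (cpalg K Q).
Local Notation RA' := (cpalg K Q').

Definition lincont (f : RA -> RA') :=
  [/\ {morph f : x y / x + y}, forall c x, f (c *: x) = c *: f x &
      forall n, exists N, forall x, mpow N x -> mpow n (f x)].

Lemma lincont0 f : lincont f -> f 0 = 0.
Proof. by case=> _ fZ _; rewrite -(scale0r 0) fZ !scale0r. Qed.

Lemma lincontN f : lincont f -> {morph f : x / - x}.
Proof. by case=> _ fZ _ x; rewrite -scaleN1r fZ scaleN1r. Qed.

Lemma lincontB f : lincont f -> {morph f : x y / x - y}.
Proof. by move=> hf x y; have [fD _ _] := hf; rewrite fD lincontN. Qed.

Lemma lincont_sum f (J : Type) (s : seq J) (P : pred J) (F : J -> RA) :
  lincont f -> f (\sum_(j <- s | P j) F j) = \sum_(j <- s | P j) f (F j).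
Proof. by move=> hf; apply: big_morph; [case: hf|exact: lincont0]. Qed.

(** Truncations are finite combinations of paths, and continuity pushes the image of the remainder
    as deep into the filtration as desired. *)
Lemma lincont_ext f g : lincont f -> lincont g ->
  (forall v w, is_path v w -> f (pbase K v w) = g (pbase K v w)) -> f =1 g.
Proof.
move=> hf hg fg x; apply: mpow_eq => n.
have [_ fZ /(_ n)[N1 h1]] := hf; have [_ gZ /(_ n)[N2 h2]] := hg.
pose y := trunc (N1 + N2)%N x.
have -> : f x - g x = f (x - y) - g (x - y).
  rewrite !lincontB // opprB.
  have -> : f y = g y.
    rewrite !lincont_sum //; apply: eq_bigr => p _; rewrite fZ gZ fg //.
    exact: path_valP.
  by rewrite addrA subrK.
have hy := @mpow_trunc _ _ _ (N1 + N2)%N x.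
apply: mpowB; [apply: h1|apply: h2]; apply: mpowW hy.
  by rewrite leqW ?leq_addr.
by rewrite leqW ?leq_addl.
Qed.

(** Under this condition only finitely many paths contribute to each coefficient of [path_ext f x].
    Without it the sum in [path_ext] could have infinite support and would then be 0 by
    convention. *)
Definition pcont (f : qpath Q -> RA') :=
  forall n, exists N, forall p, (N <= psize p)%N -> mpow n (f p).

Lemma path_extE (f : qpath Q -> RA') x q N :
  (forall p, (N < psize p)%N -> x p * f p q = 0) ->
  path_ext f x q = \sum_(p <- paths_le Q N) x p * f p q.
Proof.
move=> h; rewrite /path_ext (@fsbigTE _ _ _ _ [fset p in paths_le Q N]%fset).
  apply: perm_big; apply: uniq_perm; rewrite ?fset_uniq ?undup_uniq // => p.
  by rewrite inE.
by move=> p; rewrite !inE mem_paths_le -ltnNge => /h.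
Qed.

Lemma path_ext_lincont f : pcont f -> lincont (path_ext f).
Proof.
move=> hf.
have H q : exists N, forall x, path_ext f x q =
    \sum_(p <- paths_le Q N) x p * f p q.
  have [N hN] := hf (psize q).+1; exists N => x; apply: path_extE => p hp.
  by rewrite (coefE (f p)) hN ?mulr0 // ltnW.
split.
- move=> x y; apply: funext => q; have [N hN] := H q.
  rewrite [RHS](_ : _ = path_ext f x q + path_ext f y q) // !hN -big_split.
  by apply: eq_bigr => p _; exact: mulrDl.
- move=> c x; apply: funext => q; have [N hN] := H q.
  rewrite [RHS](_ : _ = c * path_ext f x q) // !hN mulr_sumr.
  by apply: eq_bigr => p _; exact/esym/mulrA.
- move=> n; have [N hN] := hf n; exists N.+1 => x hx v w hw.
  have [pf|npf] := boolP (is_path v w); last by rewrite coef_npath.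
  rewrite coef_path (@path_extE _ _ _ N) => [|p hp]; last first.
    by rewrite (coefE (f p)) hN ?mulr0 // ltnW.
  rewrite big1_seq // => p /=; rewrite mem_paths_le => hp.
  by rewrite coefE hx ?mul0r.
Qed.

Lemma path_ext_pbase f p : pcont f ->
  path_ext f (pbase K (phead p) (pword p)) = f p.
Proof.
move=> hf; apply: funext => q.
rewrite (@path_extE _ _ _ (psize p)) => [|p' hp'].
  rewrite (eq_bigr (fun p' => f p' q * (p == p')%:R)) => [|p' _].
    by rewrite sum_pbaseE leqnn.
  by rewrite pbaseE mulrC eq_sym.
rewrite pbaseE; case: eqP => [e|_]; last by rewrite mul0r.
by rewrite e ltnn in hp'.
Qed.

Lemma eq_path_ext (f g : qpath Q -> RA') x :
  (forall p, x p != 0 -> f p = g p) -> path_ext f x = path_ext g x.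
Proof.
move=> h; apply: funext => q; apply: eq_fsbigr => p _.
by have [->|/h ->//] := eqVneq (x p) 0; rewrite !mul0r.
Qed.

End LinearContinuous.

Lemma lincont_comp (K : fieldType) (V : finType) (Q1 Q2 Q3 : quiver V)
    (f : cpalg K Q2 -> cpalg K Q3) (g : cpalg K Q1 -> cpalg K Q2) :
  lincont f -> lincont g -> lincont (f \o g).
Proof.
move=> [fD fZ fc] [gD gZ gc]; split=> [x y|c x|n] /=; rewrite ?gD ?gZ //.
have [N1 h1] := fc n; have [N2 h2] := gc N1; exists N2 => x hx.
exact/h1/h2.
Qed.

Section Homomorphisms.
Variables (K : fieldType) (V : finType) (Q Q' : quiver V).
Local Notation RA := (cpalg K Q).
Local Notation RA' := (cpalg K Q').
Implicit Types (f g : RA -> RA').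

(* Linearity (rhomZ) and continuity (rhom_mpow) are automatic. *)
Definition rhom f :=
  [/\ {morph f : x y / x + y}, {morph f : x y / x * y} &
      forall (c : K) v, f (c *: vert Q v) = c *: vert Q' v].

Lemma rhomD f : rhom f -> {morph f : x y / x + y}. Proof. by case. Qed.
Lemma rhomM f : rhom f -> {morph f : x y / x * y}. Proof. by case. Qed.

Lemma rhom_vert f v : rhom f -> f (vert Q v) = vert Q' v.
Proof. by case=> _ _ /(_ 1 v); rewrite !scale1r. Qed.

Lemma rhom0 f : rhom f -> f 0 = 0.
Proof.
by case=> fD _ _; apply: (@addrI _ (f 0)); rewrite -fD !addr0.
Qed.

Lemma rhomN f : rhom f -> {morph f : x / - x}.
Proof.
move=> hf x; apply: (@addrI _ (f x)); have [fD _ _] := hf.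
by rewrite -fD !subrr rhom0.
Qed.

Lemma rhomB f : rhom f -> {morph f : x y / x - y}.
Proof. by move=> hf x y; rewrite (rhomD hf) rhomN. Qed.

Lemma rhom_sum f (J : Type) (s : seq J) (P : pred J) (F : J -> RA) :
  rhom f -> f (\sum_(j <- s | P j) F j) = \sum_(j <- s | P j) f (F j).
Proof. by move=> hf; apply: big_morph; [case: hf|exact: rhom0]. Qed.

Lemma rhom1 f : rhom f -> f 1 = 1.
Proof.
move=> hf; rewrite !one_vert rhom_sum //; apply: eq_bigr => v _.
exact: rhom_vert.
Qed.

Lemma rhomZ f c x : rhom f -> f (c *: x) = c *: f x.
Proof.
move=> hf; have [_ fM fv] := hf.
have scE (Q0 : quiver V) (y : cpalg K Q0) :
    c *: y = (\sum_v c *: vert Q0 v) * y.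
  by rewrite -scaler_sumr -one_vert scalerAlc mul1r.
by rewrite !scE fM rhom_sum //; congr (_ * _); apply: eq_bigr => v _.
Qed.

Lemma rhom_word f w : rhom f -> f (word w) = \prod_(a <- w) f (arr a).
Proof.
by move=> hf; apply: big_morph; [exact: rhomM|exact: rhom1].
Qed.

(* If x has no constant term then 1 - c x is invertible for every scalar c,
   so that f x has no constant term either. *)
Lemma rhom_mpow1 f x : rhom f -> mpow 1 x -> mpow 1 (f x).
Proof.
move=> hf hx v [|//] _; apply/eqP; apply: contraT => r0.
set r := coef _ _ _ in r0.
pose t := r^-1 *: x.
have ht : mpow 1 t by apply: mpowZ.
have hX n : mpow n (t ^+ n).
  elim: n => [|n IH]; first exact: mpow0.
  by rewrite exprS -[n.+1]add1n; apply: mpowM.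
(* The geometric series of t. On a path of length n its terms from [t ^+ n.+1] on vanish. *)
pose y : RA := fun p => coef (\sum_(k < (psize p).+1) t ^+ k) (phead p) (pword p).
have hy n : mpow n (y - \sum_(k < n) t ^+ k).
  move=> u w hw; have [pf|npf] := boolP (is_path u w); last by rewrite coef_npath.
  rewrite coefB coef_path {1}/y -(subnK hw) addnC big_split_ord /=.
  rewrite coefD /psize /pword /= opprD addrA subrr add0r coef_sum big1 ?oppr0 //.
  by move=> k _; apply: hX; rewrite leq_addr.
have E : (1 - t) * y = 1.
  apply: mpow_eq => n.
  have -> : (1 - t) * y - 1 =
      (1 - t) * (y - \sum_(k < n) t ^+ k) - t ^+ n.
    rewrite mulrBr -!addrA; congr (_ + _).
    have -> : (1 - t) * (\sum_(k < n) t ^+ k) = 1 - t ^+ n.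
      elim: n => [|n IH]; first by rewrite big_ord0 mulr0 expr0 subrr.
      by rewrite big_ord_recr /= mulrDr IH mulrBl mul1r -exprS addrA subrK.
    by rewrite opprB addrAC subrr add0r.
  by apply: mpowB; [apply: mpowMr|].
(* At v the constant term of f (1 - t) is 1 - r^-1 r = 0, although f (1 - t) is invertible. *)
have := congr1 (fun z => coef z v [::]) (congr1 f E).
rewrite (rhomM hf) rhomB // rhom1 // rhomZ // coefM big_nat1 coefB coef_one.
by rewrite coefZ mulVf // subrr mul0r => /esym/eqP; rewrite oner_eq0.
Qed.

Lemma rhom_arr f (a : Q) : rhom f ->
  vert Q' (hd a) * f (arr a) * vert Q' (tl a) = f (arr a).
Proof.
move=> hf.
by rewrite -!(rhom_vert _ hf) -!(rhomM hf) vert_arr arr_vert.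
Qed.

Lemma rhom_mpow f d x : rhom f -> mpow d x -> mpow d (f x).
Proof.
move=> hf; elim: d x => [//|d IH] x hx.
rewrite (decomp1 (mpowW _ hx)) // rhom_sum //; apply: mpow_sum => a _.
rewrite (rhomM hf) -[d.+1]add1n; apply: mpowM.
  by apply: rhom_mpow1 => //; exact: mpow_arr.
by apply: IH; exact: mpow_ldiv.
Qed.

Lemma rhom_lincont f : rhom f -> lincont f.
Proof.
move=> hf; split; [by case: hf|by move=> *; rewrite rhomZ|].
by move=> n; exists n => x; exact: rhom_mpow.
Qed.

Lemma rhom_ext f g : rhom f -> rhom g ->
  (forall a : Q, f (arr a) = g (arr a)) -> f =1 g.
Proof.
move=> hf hg fg; apply: lincont_ext; try exact: rhom_lincont.
move=> v w _; rewrite (rhomM hf) (rhomM hg) !rhom_vert // !rhom_word //.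
by congr (_ * _); apply: eq_bigr.
Qed.

(** From f (a y) - g (a y) = (f a - g a) f y + g a (f y - g y): the first summand gains a degree
    because f a - g a lies in m^2, the second by induction. *)
Lemma rhom_close f g d x : rhom f -> rhom g ->
  (forall a : Q, mpow 2 (f (arr a) - g (arr a))) ->
  mpow d x -> mpow d.+1 (f x - g x).
Proof.
move=> hf hg fg.
have step z d' : (forall a, mpow d' (f (ldiv a z) - g (ldiv a z))) ->
    (forall a, mpow d'.-1 (f (ldiv a z))) ->
    mpow d'.+1 (f (\sum_a arr a * ldiv a z) - g (\sum_a arr a * ldiv a z)).
  move=> h1 h2; rewrite !rhom_sum // -sumrB; apply: mpow_sum => a _.
  rewrite (rhomM hf) (rhomM hg).
  rewrite (_ : _ - _ = (f (arr a) - g (arr a)) * f (ldiv a z) +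
    g (arr a) * (f (ldiv a z) - g (ldiv a z))); last first.
    by rewrite mulrBl mulrBr addrA subrK.
  apply: mpowD.
    apply: (@mpowW _ _ _ (2 + d'.-1)); first by case: d' {h1 h2}.
    by apply: mpowM => //; exact: h2.
  rewrite -add1n; apply: mpowM => //.
  by apply: rhom_mpow1 => //; exact: mpow_arr.
elim: d x => [|d IH] x hx.
  rewrite (decomp x) (rhomD hf) (rhomD hg) opprD addrACA.
  set z := \sum_v _; have -> : f z = g z.
    rewrite !rhom_sum //; apply: eq_bigr => v _.
    by rewrite !rhomZ // !rhom_vert.
  by rewrite subrr add0r; apply: step.
rewrite (decomp1 (mpowW _ hx)) //; apply: step => a.
  by apply: IH; exact: mpow_ldiv.
by apply: rhom_mpow => //; exact: mpow_ldiv.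
Qed.

End Homomorphisms.

Section HomCategory.
Variables (K : fieldType) (V : finType).
Implicit Types Q : quiver V.

Lemma rhom_id Q : rhom (@id (cpalg K Q)). Proof. by []. Qed.

Lemma rhom_comp Q1 Q2 Q3 (f : cpalg K Q2 -> cpalg K Q3)
    (g : cpalg K Q1 -> cpalg K Q2) : rhom f -> rhom g -> rhom (f \o g).
Proof.
move=> [fD fM fv] [gD gM gv].
by split=> [x y|x y|c v] /=; rewrite ?gD ?fD ?gM ?fM ?gv ?fv.
Qed.

Lemma rhom_inv Q1 Q2 (f : cpalg K Q1 -> cpalg K Q2)
    (g : cpalg K Q2 -> cpalg K Q1) :
  cancel f g -> cancel g f -> rhom f -> rhom g.
Proof.
move=> fK gK [fD fM fv].
split=> [x y|x y|c v]; apply: (can_inj fK); rewrite ?fD ?fM ?fv !gK //.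
Qed.

Lemma lincont_mulr Q (y : cpalg K Q) : lincont (fun x => x * y).
Proof.
split=> [x z|c x|n]; rewrite ?mulrDl ?scalerAlc //.
by exists n => x; exact: mpowMl.
Qed.

Lemma lincont_mull Q (y : cpalg K Q) : lincont (fun x => y * x).
Proof.
split=> [x z|c x|n]; rewrite ?mulrDr ?scalerArc //.
by exists n => x; exact: mpowMr.
Qed.

End HomCategory.

Section AlgExt.
Variables (K : fieldType) (V : finType) (Q Q' : quiver V).
Variable g : Q -> cpalg K Q'.

Definition end_compatible := forall a,
  mpow 1 (g a) /\ vert Q' (hd a) * g a * vert Q' (tl a) = g a.

Hypothesis gP : end_compatible.

Lemma end_compatible_l a : vert Q' (hd a) * g a = g a.
Proof. by have [_ <-] := gP a; rewrite !mulrA vert_idem. Qed.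

Lemma end_compatible_r a : g a * vert Q' (tl a) = g a.
Proof. by have [_ <-] := gP a; rewrite -!mulrA vert_idem. Qed.

Lemma end_compatible_prod_vert v w v' :
  vert Q' v * (\prod_(a <- w) g a) * vert Q' v' =
  (word_tail v w == v')%:R *: (vert Q' v * (\prod_(a <- w) g a)).
Proof.
elim: w v => [|a w IH] v.
  rewrite big_nil !mulr1 vertM /word_tail /=.
  by case: eqP => [->|]; rewrite ?scale0r.
rewrite big_cons -(end_compatible_r a).
transitivity (vert Q' v * g a *
    (vert Q' (tl a) * (\prod_(b <- w) g b) * vert Q' v')).
  by rewrite !mulrA.
by rewrite IH scalerArc !mulrA.
Qed.

Let G (p : qpath Q) := vert Q' (phead p) * \prod_(a <- pword p) g a.

Lemma mpow_prod (w : seq Q) : mpow (size w) (\prod_(a <- w) g a).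
Proof.
elim: w => [|a w IH]; first exact: mpow0.
by rewrite big_cons -[size _]add1n; apply: mpowM => //; have [] := gP a.
Qed.

Let Gcont : pcont G.
Proof.
move=> n; exists n => p hp; apply: mpowMr.
exact: mpowW hp (@mpow_prod _).
Qed.

Lemma alg_ext_pbase v w :
  alg_ext g (pbase K v w) = vert Q' v * \prod_(a <- w) g a.
Proof.
have [pf|npf] := boolP (is_path v w).
  exact: (path_ext_pbase (@QPath V Q (v, w) pf) Gcont).
rewrite pbase_npath // lincont0; last exact: path_ext_lincont.
elim: w v npf => [//|a w IH] v /=; rewrite negb_and => npf.
rewrite big_cons -(end_compatible_r a) -mulrA.
have [e|ne] := eqVneq (hd a) v.
  by rewrite e eqxx /= in npf; rewrite -(IH _ npf) !mulr0.
by rewrite -(end_compatible_l a) !mulrA vertM_neq ?mul0r // eq_sym.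
Qed.

Lemma alg_ext_rhom : rhom (alg_ext g).
Proof.
have lin_coef := path_ext_lincont Gcont; have [fD fZ' _] := lin_coef.
have fZ c x : alg_ext g (c *: x) = c *: alg_ext g x by exact: fZ'.
split=> [//|x y|c v]; last first.
  rewrite fZ; congr (_ *: _).
  have := alg_ext_pbase v [::].
  by rewrite /pbase word_nil big_nil !mulr1.
(* Multiplicativity is reduced to paths by density, one variable at a time. *)
apply: (lincont_ext (f := fun x => alg_ext g (x * y))
  (g := fun x => alg_ext g x * alg_ext g y)) => [||v w _].
- exact: lincont_comp lin_coef (lincont_mulr y).
- exact: lincont_comp (lincont_mulr _) lin_coef.
apply: (lincont_ext (f := fun y => alg_ext g (pbase K v w * y))
  (g := fun y => alg_ext g (pbase K v w) * alg_ext g y)) => [||v' w' _].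
- exact: lincont_comp lin_coef (lincont_mull _).
- exact: lincont_comp (lincont_mull _) lin_coef.
rewrite pbaseM fZ !alg_ext_pbase mulrA end_compatible_prod_vert scalerAlc.
by rewrite big_cat mulrA.
Qed.

Lemma alg_ext_arr a : alg_ext g (arr a) = g a.
Proof.
have := alg_ext_pbase (hd a) [:: a].
by rewrite big_seq1 end_compatible_l /pbase word1 vert_arr.
Qed.

End AlgExt.

(** * Cyclic equivalence as equality modulo the closure of the commutators *)

Section CommutatorClosure.
Variables (K : fieldType) (V : finType).
Implicit Types Q : quiver V.

Definition comm_sum Q (x : cpalg K Q) := exists s : seq (cpalg K Q * cpalg K Q),
  x = \sum_(u <- s) (u.1 * u.2 - u.2 * u.1).

(* On differences of potentials this is cyclic equivalence (cyc_equiv_commc,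
   commc_cyc_equiv), but it makes sense for all elements and is visibly preserved
   by homomorphisms. *)
Definition commc Q (x : cpalg K Q) :=
  forall d, exists2 u, comm_sum u & mpow d (x - u).

Lemma comm_sumD Q (x y : cpalg K Q) :
  comm_sum x -> comm_sum y -> comm_sum (x + y).
Proof. by move=> [s ->] [t ->]; exists (s ++ t); rewrite big_cat. Qed.

Lemma comm_sum0 Q : comm_sum (0 : cpalg K Q).
Proof. by exists [::]; rewrite big_nil. Qed.

Lemma comm_sum_comm Q (x y : cpalg K Q) : comm_sum (x * y - y * x).
Proof. by exists [:: (x, y)]; rewrite big_seq1. Qed.

Lemma comm_sumZ Q c (x : cpalg K Q) : comm_sum x -> comm_sum (c *: x).
Proof.
move=> [s ->]; exists [seq (c *: u.1, u.2) | u <- s].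
rewrite big_map scaler_sumr; apply: eq_bigr => u _ /=.
by rewrite scalerAlc scalerArc scalerBr.
Qed.

Lemma commcW Q (x : cpalg K Q) : comm_sum x -> commc x.
Proof. by move=> hx d; exists x => //; rewrite subrr; exact: mpow_0. Qed.

Lemma commcD Q (x y : cpalg K Q) : commc x -> commc y -> commc (x + y).
Proof.
move=> hx hy d; have [u hu ux] := hx d; have [v hv vy] := hy d.
exists (u + v); first exact: comm_sumD.
by rewrite opprD addrACA; exact: mpowD.
Qed.

Lemma commcZ Q c (x : cpalg K Q) : commc x -> commc (c *: x).
Proof.
move=> hx d; have [u hu ux] := hx d; exists (c *: u); first exact: comm_sumZ.
by rewrite -scalerBr; exact: mpowZ.
Qed.

Lemma commcN Q (x : cpalg K Q) : commc x -> commc (- x).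
Proof. by rewrite -scaleN1r; exact: commcZ. Qed.

Lemma commc0 Q : commc (0 : cpalg K Q). Proof. exact/commcW/comm_sum0. Qed.

Lemma commc_closed Q (x : cpalg K Q) :
  (forall d, exists2 u, commc u & mpow d (x - u)) -> commc x.
Proof.
move=> h d; have [u hu xu] := h d; have [v hv uv] := hu d.
by exists v => //; rewrite -(subrK u x) -addrA; exact: mpowD.
Qed.

Lemma rhom_commc Q1 Q2 (f : cpalg K Q1 -> cpalg K Q2) x :
  rhom f -> commc x -> commc (f x).
Proof.
move=> hf hx d; have [u [s ->] xu] := hx d.
exists (\sum_(v <- [seq (f w.1, f w.2) | w <- s]) (v.1 * v.2 - v.2 * v.1)).
  by eexists.
rewrite big_map; under eq_bigr do rewrite -!(rhomM hf) -rhomB //.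
by rewrite -rhom_sum // -rhomB //; exact: rhom_mpow.
Qed.

Lemma lin_span_ind Q (G : set (cpalg K Q)) (P : cpalg K Q -> Prop) :
  P 0 -> (forall x y, P x -> P y -> P (x + y)) ->
  (forall c x, P x -> P (c *: x)) -> (forall x, G x -> P x) ->
  forall x, lin_span G x -> P x.
Proof.
move=> P0 PD PZ PG x [n [c [g [hg ->]]]].
by apply: big_ind => // k _; apply/PZ/PG.
Qed.

Lemma lin_span_gen Q (G : set (cpalg K Q)) x : G x -> lin_span G x.
Proof.
move=> hx; exists 1%N, (fun=> 1), (fun=> x); split=> //.
by rewrite big_ord1 scale1r.
Qed.

Lemma lin_span0 Q (G : set (cpalg K Q)) : lin_span G 0.
Proof.
exists 0%N, (fun=> 0), (fun=> 0); split; first by case.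
by rewrite big_ord0.
Qed.

Lemma lin_spanD Q (G : set (cpalg K Q)) x y :
  lin_span G x -> lin_span G y -> lin_span G (x + y).
Proof.
move=> [n [c [g [hg ->]]]] [m [c' [g' [hg' ->]]]].
exists (n + m)%N, (fun k => match fintype.split k with inl j => c j | inr j => c' j end),
  (fun k => match fintype.split k with inl j => g j | inr j => g' j end).
split; first by move=> k; case: fintype.split.
rewrite big_split_ord; congr (_ + _); apply: eq_bigr => k _.
  by rewrite (unsplitK (inl k)).
by rewrite (unsplitK (inr k)).
Qed.

Lemma lin_spanZ Q (G : set (cpalg K Q)) c x :
  lin_span G x -> lin_span G (c *: x).
Proof.
move=> [n [c' [g [hg ->]]]]; exists n, (fun k => c * c' k), g; split=> //.
by rewrite scaler_sumr; apply: eq_bigr => k _; rewrite scalerA.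
Qed.

Lemma madic_closureP Q (U : set (cpalg K Q)) x :
  madic_closure U x <-> forall d, exists2 u, U u & mpow d (x - u).
Proof.
split=> h d; have [u hu hxu] := h d; exists u => //.
  move=> v w hw; have [pf|npf] := boolP (is_path v w); last by rewrite coef_npath.
  by rewrite coefB !coef_path hxu // subrr.
by move=> p hp; apply/eqP; rewrite -subr_eq0 !coefE -coefB hxu.
Qed.

(** A single rotation is the commutator of the first arrow with the rest of the cycle. *)
Lemma cyc_equiv_commc Q (S S' : cpalg K Q) : cyc_equiv S S' -> commc (S - S').
Proof.
move/madic_closureP => h; apply: commc_closed => d; have [u hu ux] := h d.
exists u => //; apply: lin_span_ind hu.
- exact: commc0.
- by move=> *; exact: commcD.
- by move=> *; exact: commcZ.
move=> _ [p hp ->]; apply: commcW.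
case: (pword p) => [|a w]; first by rewrite subrr; exact: comm_sum0.
by rewrite rot1_cons -cats1 word_cat word1 word_cons; exact: comm_sum_comm.
Qed.

(** Continuous projection onto the potentials. It is the way back from commutators to rotations,
    since the commutator of two paths may have terms that are not cycles. *)
Definition cycle_part Q (x : cpalg K Q) : cpalg K Q :=
  fun p => (is_cycle p)%:R * x p.

Lemma coef_cycle_part Q (x : cpalg K Q) v w :
  coef (cycle_part x) v w = ((w != [::]) && (v == word_tail v w))%:R * coef x v w.
Proof.
have [pf|npf] := boolP (is_path v w); last by rewrite !coef_npath ?mulr0.
rewrite !coef_path /cycle_part; congr ((nat_of_bool _)%:R * _).
by rewrite /is_cycle /psize /pword /ptail lt0n size_eq0.
Qed.

Lemma cycle_part_id Q (x : cpalg K Q) : potential x -> cycle_part x = x.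
Proof.
move=> hx; apply: funext => p; rewrite /cycle_part.
by have [->|/hx ->] := eqVneq (x p) 0; rewrite ?mulr0 ?mul1r.
Qed.

Lemma lincont_cycle_part Q : lincont (@cycle_part Q).
Proof.
split=> [x y|c x|n].
- by apply: coef_ext => v w _; rewrite coefD !coef_cycle_part coefD mulrDr.
- by apply: coef_ext => v w _; rewrite coefZ !coef_cycle_part coefZ mulrCA.
by exists n => x hx v w hw; rewrite coef_cycle_part hx ?mulr0.
Qed.

Lemma cycle_part_pbase Q v (w : seq Q) : cycle_part (pbase K v w) =
  ((w != [::]) && (v == word_tail v w))%:R *: pbase K v w.
Proof.
apply: coef_ext => v' w' _; rewrite coefZ coef_cycle_part coef_pbase.
case: (eqVneq (v', w') (v, w)) => [[-> ->] //|_].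
by rewrite andbF !mulr0.
Qed.

Lemma pbase_word Q v a (w : seq Q) :
  is_path v (a :: w) -> pbase K v (a :: w) = word (a :: w).
Proof.
by case/andP => /eqP <- _; rewrite /pbase word_cons mulrA vert_arr.
Qed.

(** The letters of w1 move to the end one at a time, each by a generator. *)
Lemma span_rot Q v (w1 w2 : seq Q) : is_path v (w1 ++ w2) ->
  v = word_tail v (w1 ++ w2) ->
  lin_span (rotation_gens (K := K) (Q := Q)) (word (w1 ++ w2) - word (w2 ++ w1)).
Proof.
elim: w1 v w2 => [|a w1 IH] v w2 pf cyc.
  by rewrite cats0 subrr; exact: lin_span0.
rewrite -(subrK (word ((w1 ++ w2) ++ [:: a])) (word (_ ++ w2))) -addrA.
apply: lin_spanD.
  apply: lin_span_gen; exists (@QPath V Q (v, (a :: w1) ++ w2) pf) => /=.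
    by apply/andP; split=> //; apply/eqP.
  by rewrite /pword /= rot1_cons cats1.
move: pf => /= /andP[/eqP hv pf].
have ht : word_tail (tl a) (w1 ++ w2) = v by rewrite [RHS]cyc.
have := IH (tl a) (w2 ++ [:: a]); rewrite catA -[(w2 ++ _) ++ w1]catA; apply.
  by rewrite is_path_cat pf ht /= hv eqxx.
by rewrite word_tail_cat ht.
Qed.

(** For two paths p, q the projection keeps p q and q p only if both are cycles, and these are
    rotations of each other. Truncating x and y reduces to finitely many pairs of paths at the cost
    of an error in m^d. *)
Lemma cycle_part_comm Q (x y : cpalg K Q) d :
  exists2 u, lin_span (rotation_gens (K := K) (Q := Q)) u &
    mpow d (cycle_part (x * y - y * x) - u).
Proof.
have cl := lincont_cycle_part Q; have [_ cZ _] := cl.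
have H v w v' w' : is_path v w -> is_path v' w' ->
    lin_span (rotation_gens (K := K) (Q := Q)) (cycle_part
      (pbase K v w * pbase K v' w' - pbase K v' w' * pbase K v w)).
  move=> pf pf'; rewrite !pbaseM.
  rewrite lincontB // !cZ !cycle_part_pbase !word_tail_cat.
  case: (eqVneq (word_tail v w) v') => [e|ne]; last first.
    rewrite scale0r add0r -scaleN1r; apply: lin_spanZ.
    case: (eqVneq _ v) => [e2|_]; last by rewrite scale0r; exact: lin_span0.
    rewrite e2; case: (eqVneq v' _) => [e'|_]; last first.
      by rewrite andbF scale0r scaler0; exact: lin_span0.
    by rewrite e' eqxx in ne.
  rewrite e; case: (eqVneq (word_tail v' w') v) => [e'|ne']; last first.
    rewrite scale0r subr0 andbF scale0r scaler0; exact: lin_span0.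
  rewrite e' e eqxx !andbT !scale1r.
  have sw : (w' ++ w != [::]) = (w ++ w' != [::]).
    by rewrite -!size_eq0 !size_cat addnC.
  rewrite sw; have [_|n0] := eqVneq (w ++ w') [::].
    by rewrite !scale0r subr0; exact: lin_span0.
  have hp : is_path v (w ++ w') by rewrite is_path_cat pf e.
  have hp' : is_path v' (w' ++ w) by rewrite is_path_cat pf' e'.
  have pw u (t : seq Q) : is_path u t -> t != [::] -> pbase K u t = word t.
    by case: t => // a t ht _; exact: pbase_word.
  rewrite !scale1r !pw ?sw //; apply: (span_rot hp).
  by rewrite word_tail_cat e e'.
pose x' := trunc d x; pose y' := trunc d y.
exists (cycle_part (x' * y' - y' * x')).
  rewrite /x' /y' /trunc mulr_suml mulr_sumr -sumrB lincont_sum //.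
  apply: big_ind => [|? ?|p _]; [exact: lin_span0|exact: lin_spanD|].
  rewrite mulr_sumr mulr_suml -sumrB lincont_sum //.
  apply: big_ind => [|? ?|q _]; [exact: lin_span0|exact: lin_spanD|].
  rewrite !scalerAlc !scalerArc !scalerA [y q * _]mulrC -scalerBr cZ.
  by apply/lin_spanZ/H; exact: path_valP.
rewrite -lincontB // => v w hw; rewrite coef_cycle_part.
have hx : mpow d (x - x') by apply: (mpowW _ (@mpow_trunc _ _ _ d x)).
have hy : mpow d (y - y') by apply: (mpowW _ (@mpow_trunc _ _ _ d y)).
suff -> : coef (x * y - y * x - (x' * y' - y' * x')) v w = 0 by rewrite mulr0.
suff : mpow d (x * y - y * x - (x' * y' - y' * x')) by apply.
have -> : x * y - y * x - (x' * y' - y' * x') =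
   ((x - x') * y + x' * (y - y')) - ((y - y') * x + y' * (x - x')).
  by rewrite !mulrBl !mulrBr !addrA !subrK !opprD !opprK addrACA addrA.
by apply: mpowB; apply: mpowD; do ?[exact: mpowMl|exact: mpowMr].
Qed.

(** The projection [cycle_part] fixes S - S' and preserves the filtration, so it can be applied to
    the approximating sums of commutators. *)
Lemma commc_cyc_equiv Q (S S' : cpalg K Q) : potential S -> potential S' ->
  commc (S - S') -> cyc_equiv S S'.
Proof.
move=> hS hS' h; apply/madic_closureP => d.
have cl := lincont_cycle_part Q.
have [_ [s ->] hd] := h d.
have hz : mpow d (S - S' - cycle_part (\sum_(u <- s) (u.1 * u.2 - u.2 * u.1))).
  rewrite -{1}(cycle_part_id hS) -{1}(cycle_part_id hS') -!lincontB //.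
  by move=> v w hw; rewrite coef_cycle_part hd ?mulr0.
suff [r hr hzr] : exists2 r, lin_span (rotation_gens (K := K) (Q := Q)) r &
    mpow d (cycle_part (\sum_(u <- s) (u.1 * u.2 - u.2 * u.1)) - r).
  exists r => //; rewrite -(subrK (cycle_part (\sum_(u <- s) (u.1 * u.2 - u.2 * u.1))) (S - S')).
  by rewrite -addrA; exact: mpowD.
elim: s {hd hz} => [|u s [r hr hzr]].
  rewrite big_nil; exists 0; first exact: lin_span0.
  by rewrite (lincont0 cl) subrr; exact: mpow_0.
have [r' hr' hur] := cycle_part_comm u.1 u.2 d.
exists (r' + r); first exact: lin_spanD.
rewrite big_cons; have [-> _ _] := cl.
by rewrite opprD addrACA; exact: mpowD.
Qed.

(** The right side speaks only of m and the idempotents e_v, which every homomorphism over R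
    respects. *)
Lemma potentialP Q (x : cpalg K Q) : potential x <->
  mpow 1 x /\ forall u v, u != v -> vert Q u * x * vert Q v = 0.
Proof.
split=> [h|[h1 h2] p].
  have hx v w : coef x v w != 0 -> (w != [::]) && (v == word_tail v w).
    have [pf|npf] := boolP (is_path v w); last by rewrite coef_npath ?eqxx.
    rewrite coef_path => /h; rewrite /is_cycle /psize lt0n size_eq0.
    by rewrite /ptail.
  split=> [v [|//] _|u v uv].
    by apply/eqP; apply: contraT => /hx.
  apply: coef_ext => v' w _; rewrite coef_Mvert coef_vertM coef0.
  apply/eqP; apply: contraT; rewrite !mulf_eq0 !negb_or => /and3P[h1 h2].
  move=> /hx /andP[_ /eqP e]; move: h1 h2 uv; rewrite -e.
  have [<-|_] := eqVneq v' v; last by rewrite eqxx.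
  by have [_|_] := eqVneq v' u; rewrite ?eqxx.
rewrite coefE => nz; apply/andP; split.
  by rewrite lt0n; apply: contra nz; rewrite size_eq0 => /eqP ->; rewrite h1.
apply: contraT => ne; have := congr1 (fun z => coef z (phead p) (pword p)) (h2 _ _ ne).
rewrite coef_Mvert coef_vertM coef0 eqxx mul1r /ptail eqxx mul1r => e.
by rewrite e eqxx in nz.
Qed.

Lemma rhom_potential Q1 Q2 (f : cpalg K Q1 -> cpalg K Q2) x :
  rhom f -> potential x -> potential (f x).
Proof.
move=> hf /potentialP[h1 h2]; apply/potentialP; split.
  exact: rhom_mpow.
by move=> u v uv; rewrite -!(rhom_vert _ hf) -!(rhomM hf) h2 // rhom0.
Qed.

Lemma potentialD Q (x y : cpalg K Q) :
  potential x -> potential y -> potential (x + y).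
Proof.
move=> hx hy p; have [e|/hx //] := eqVneq (x p) 0.
by rewrite [(x + y) p](_ : _ = x p + y p) // e add0r => /hy.
Qed.

End CommutatorClosure.

(** * The inverse function theorem for complete path algebras *)

Section InverseFunction.
Variables (K : fieldType) (V : finType).
Implicit Types Q : quiver V.

(** Successive approximation: adding the error e = y - u x to x turns the error into e - u e, which
    lies one step deeper in the filtration because u is the identity modulo m^2 on arrows. *)
Lemma endo_bij Q (u : cpalg K Q -> cpalg K Q) : rhom u ->
  (forall a : Q, mpow 2 (u (arr a) - arr a)) ->
  exists2 u', cancel u u' & cancel u' u.
Proof.
move=> hu ha.
have close d x : mpow d x -> mpow d.+1 (u x - x).
  exact: (rhom_close hu (@rhom_id _ _ Q)).
have uinj : injective u.
  move=> x y e; apply: mpow_eq; elim=> [//|d IH].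
  have := close _ _ IH; rewrite rhomB // e subrr sub0r => /mpowN.
  by rewrite opprK.
pose app (y : cpalg K Q) n : cpalg K Q := iter n (fun x : cpalg K Q => x + (y - u x)) 0.
have hy (y : cpalg K Q) n : mpow n (y - u (app y n)).
  elim: n => [//|n IH] /=.
  rewrite (rhomD hu) opprD addrA -opprB.
  by apply/mpowN/close.
(* From stage n on the coefficients on paths of length below n no longer change, so those of length
   d are read off at stage d + 1. *)
pose u' (y : cpalg K Q) : cpalg K Q := fun p => app y (psize p).+1 p.
have hu' (y : cpalg K Q) n : mpow n (u' y - app y n).
  move=> v w hw; have [pf|npf] := boolP (is_path v w); last by rewrite coef_npath.
  rewrite coefB coef_path {1}/u' coefE -[phead _]/v -[pword _]/w -[psize _]/(size w).
  rewrite -(subnK hw) addnC; elim: (n - _)%N => [|k IH]; first by rewrite addn0 subrr.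
  rewrite addnS; set z := app y (size w).+1 in IH *.
  have appS m : app y m.+1 = app y m + (y - u (app y m)) by [].
  rewrite appS coefD opprD addrA IH sub0r (hy y) ?oppr0 //.
  exact: leq_addr.
have u'K : cancel u' u.
  move=> y; apply/esym/mpow_eq => n.
  have -> : y - u (u' y) = (y - u (app y n)) + u (app y n - u' y).
    by rewrite rhomB // addrA subrK.
  apply: mpowD => //.
  by apply: rhom_mpow => //; rewrite -opprB; apply: mpowN.
by exists u' => // x; apply: uinj; rewrite u'K.
Qed.

(** Only the linear parts of f and g have to be mutually inverse. Both composites are then
    bijective, which gives f a left and a right inverse. *)
Lemma rhom_bij Q Q' (f : cpalg K Q -> cpalg K Q') (g : cpalg K Q' -> cpalg K Q) :
  rhom f -> rhom g ->
  (forall a : Q, mpow 2 (g (f (arr a)) - arr a)) ->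
  (forall a : Q', mpow 2 (f (g (arr a)) - arr a)) ->
  exists f', [/\ rhom f', cancel f f' & cancel f' f].
Proof.
move=> hf hg h1 h2.
have [k kK Kk] := endo_bij (rhom_comp hg hf) h1.
have [l lK Kl] := endo_bij (rhom_comp hf hg) h2.
have c1 : cancel f (k \o g) by move=> x /=; exact: kK.
have c2 : cancel (k \o g) f.
  move=> y; have e : f (g (l y)) = y := Kl y.
  have e2 : k (g (f (g (l y)))) = g (l y) := kK _.
  by rewrite e in e2; rewrite /= e2.
by exists (k \o g); split=> //; exact: rhom_inv c1 c2 hf.
Qed.

End InverseFunction.

(** * Restriction *)

Section PartialArrowMaps.
Variables (K : fieldType) (V : finType) (Q Q' : quiver V).

(** An arrow without image is sent to 0. This one form covers restrictions, inclusions of subquivers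
    and the projection of a direct sum to a summand. *)
Definition oarr (o : Q -> option Q') (a : Q) : cpalg K Q' :=
  if o a is Some b then arr b else 0.

Definition keeps_ends (o : Q -> option Q') :=
  forall a b, o a = Some b -> hd b = hd a /\ tl b = tl a.

Lemma end_compatible_oarr o : keeps_ends o -> end_compatible (oarr o).
Proof.
move=> ho a; rewrite /oarr; case e: (o a) => [b|].
  have [<- <-] := ho _ _ e; rewrite vert_arr arr_vert.
  by split=> //; exact: mpow_arr.
by rewrite mulr0 mul0r; split=> //; exact: mpow_0.
Qed.

Lemma oarr_rhom o : keeps_ends o -> rhom (alg_ext (oarr o)).
Proof. by move=> ho; apply/alg_ext_rhom/end_compatible_oarr. Qed.

Lemma oarr_arr o a : keeps_ends o -> alg_ext (oarr o) (arr a) = oarr o a.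
Proof. by move=> ho; rewrite alg_ext_arr //; exact: end_compatible_oarr. Qed.

End PartialArrowMaps.

Section Equivalence.
Variables (K : fieldType) (V : finType).
Implicit Types P : qpair K V.

(* Right-equivalence for elements which need not be potentials. *)
Definition eqv P P' := exists f g,
  [/\ rhom f, rhom g, cancel f g, cancel g f &
      commc (f (qpot P) - qpot P')].

Lemma eqv_sym P P' : eqv P P' -> eqv P' P.
Proof.
move=> [f [g [hf hg fK gK h]]]; exists g, f; split=> //.
rewrite -[in X in _ - X](fK (qpot P)) -rhomB // -opprB.
by apply: rhom_commc => //; exact: commcN.
Qed.

Lemma eqv_trans P1 P2 P3 : eqv P1 P2 -> eqv P2 P3 -> eqv P1 P3.
Proof.
move=> [f [g [hf hg fK gK h]]] [f' [g' [hf' hg' fK' gK' h']]].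
exists (f' \o f), (g \o g'); split.
- exact: rhom_comp.
- exact: rhom_comp.
- by move=> x /=; rewrite fK' fK.
- by move=> x /=; rewrite gK gK'.
rewrite /= -(subrK (f' (qpot P2)) (f' (f _))) -addrA -rhomB //.
by apply: commcD => //; exact: rhom_commc.
Qed.

Lemma right_equiv_eqv P P' : right_equiv P P' -> eqv P P'.
Proof.
move=> [phi [[g gK Kg] pv /cyc_equiv_commc h]].
have hf : rhom phi by split=> //; [exact: rmorphD|exact: rmorphM].
by exists phi, g; split=> //; exact: rhom_inv gK Kg hf.
Qed.

Lemma eqv_right_equiv P P' : potential (qpot P) -> potential (qpot P') ->
  eqv P P' -> right_equiv P P'.
Proof.
move=> hP hP' [f [g [hf hg fK gK h]]].
pose A := GRing.isZmodMorphism.Build _ _ f (rhomB hf).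
pose M := GRing.isMonoidMorphism.Build _ _ f (rhom1 hf, rhomM hf).
pose F : {rmorphism cpalg K (qquiver P) -> cpalg K (qquiver P')} :=
  HB.pack f A M.
exists F; split.
- by exists g.
- by have [_ _ hv] := hf; exact: hv.
by apply: commc_cyc_equiv => //; exact: rhom_potential.
Qed.

End Equivalence.

Section Restrictions.
Variables (K : fieldType) (V : finType) (I : {set V}).
Implicit Types Q : quiver V.

Local Notation inI a := ((hd a \in I) && (tl a \in I)).

Lemma keeps_ends_insub Q : keeps_ends (insub : Q -> option (restrict_quiver I Q)).
Proof. by move=> a b; case: insubP => // u _ <- [<-]. Qed.

Lemma keeps_ends_val Q : keeps_ends (fun b : restrict_quiver I Q => Some (val b)).
Proof. by move=> a b [<-]. Qed.

Local Notation rarr := (@restrict_arr K _ I _).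
Local Notation rho := (alg_ext (@restrict_arr K _ I _)).
Local Notation iota Q := (alg_ext (K := K) (oarr K
  (fun b : restrict_quiver I Q => Some (val b)))).

Lemma rho_rhom Q : rhom (alg_ext (@restrict_arr K _ I Q)).
Proof. exact: oarr_rhom (@keeps_ends_insub Q). Qed.

Lemma rho_arr Q (a : Q) : rho (arr a) = rarr a.
Proof. exact: oarr_arr (@keeps_ends_insub Q). Qed.

Lemma restrict_arr_val Q (b : restrict_quiver I Q) :
  rarr (val b) = arr b.
Proof. by rewrite /restrict_arr valK. Qed.

Lemma restrict_arr_out Q (a : Q) : ~~ inI a -> rarr a = 0.
Proof. by move=> h; rewrite /restrict_arr insubF //; exact: negbTE. Qed.

Lemma iota_rhom Q : rhom (iota Q).
Proof. exact: oarr_rhom (@keeps_ends_val Q). Qed.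

Lemma iota_arr Q (b : restrict_quiver I Q) : iota Q (arr b) = arr (val b).
Proof. exact: oarr_arr (@keeps_ends_val Q). Qed.

Lemma iotaK Q : cancel (iota Q) rho.
Proof.
apply: (rhom_ext (rhom_comp (rho_rhom Q) (iota_rhom Q)) (@rhom_id _ _ _)) => b.
by rewrite /= iota_arr rho_arr restrict_arr_val.
Qed.

Lemma restrict_vertl Q v (x : cpalg K (restrict_quiver I Q)) :
  v \notin I -> mpow 1 x -> vert _ v * x = 0.
Proof.
move=> vI hx; apply: coef_ext => u [|b w] pf; rewrite coef_vertM coef0.
  by rewrite hx ?mulr0.
case: eqP => [e|]; rewrite ?mul0r //; case/andP: pf => /eqP hb _.
by have /andP[h _] := valP b; move: vI; rewrite -e -hb h.
Qed.

Lemma restrict_vertr Q v (x : cpalg K (restrict_quiver I Q)) :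
  v \notin I -> mpow 1 x -> x * vert _ v = 0.
Proof.
move=> vI hx; apply: coef_ext => u w pf; rewrite coef_Mvert coef0.
case: eqP => [e|]; rewrite ?mul0r // mul1r.
case/lastP: w pf e => [|w b] _ e; first by rewrite hx.
have /andP[_ h] := valP b; move: vI.
by rewrite -e /word_tail map_rcons last_rcons h.
Qed.

(** An arrow outside I has an end v outside I. Its image under f keeps that end, and e_v annihilates
    m in the restricted algebra, so the restriction of the image is 0. Thus f descends to the
    restrictions. *)
Lemma rho_factor Q Q' (f : cpalg K Q -> cpalg K Q') : rhom f ->
  forall x, rho (f (iota Q (rho x))) = rho (f x).
Proof.
move=> hf.
have h1 := rhom_comp (rho_rhom Q') hf.
apply: (rhom_ext (rhom_comp h1 (rhom_comp (iota_rhom Q) (rho_rhom Q))) h1) => a.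
rewrite /= rho_arr; have [aI|aI] := boolP (inI a).
  by rewrite /restrict_arr insubT iota_arr.
rewrite restrict_arr_out // (rhom0 (iota_rhom Q)) (rhom0 hf) (rhom0 (rho_rhom Q')).
have := rhom_arr a h1; rewrite /=.
have hm : mpow 1 (rho (f (arr a))) by apply: (rhom_mpow1 h1); exact: mpow_arr.
move: aI; rewrite negb_and => /orP[] vI.
  by rewrite restrict_vertl // mul0r.
by rewrite -mulrA [rho _ * _]restrict_vertr // mulr0.
Qed.

Lemma eqv_restriction (P P' : qpair K V) :
  eqv P P' -> eqv (restriction I P) (restriction I P').
Proof.
move=> [f [g [hf hg fK gK h]]].
exists (rho \o f \o iota _), (rho \o g \o iota _); split.
- exact: rhom_comp (rhom_comp (@rho_rhom _) hf) (iota_rhom _).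
- exact: rhom_comp (rhom_comp (@rho_rhom _) hg) (iota_rhom _).
- by move=> x /=; rewrite rho_factor // fK iotaK.
- by move=> x /=; rewrite rho_factor // gK iotaK.
rewrite /= rho_factor // -(rhomB (@rho_rhom _)).
exact: rhom_commc (@rho_rhom _) h.
Qed.

Section Embedding.
Variables (Q1 Q : quiver V) (kappa : Q1 -> Q).
Hypothesis kappa_hd : forall a, hd (kappa a) = hd a.
Hypothesis kappa_tl : forall a, tl (kappa a) = tl a.
Hypothesis kappa_inj : injective kappa.
Hypothesis kappa_in : forall a : Q1, inI a.
Hypothesis kappa_onto : forall x : Q, inI x -> exists a, kappa a = x.

Definition okappa (x : Q) : option Q1 := [pick a | kappa a == x].

Lemma okappa_kappa a : okappa (kappa a) = Some a.
Proof.
by rewrite /okappa; case: pickP => [b /eqP/kappa_inj -> //|/(_ a)]; rewrite eqxx.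
Qed.

Lemma okappa_out (x : Q) : ~~ inI x -> okappa x = None.
Proof.
rewrite /okappa; case: pickP => // b /eqP <-.
by rewrite kappa_hd kappa_tl kappa_in.
Qed.

Lemma keeps_ends_okappa : keeps_ends okappa.
Proof.
move=> x a; rewrite /okappa; case: pickP => // b /eqP <- [<-].
by rewrite kappa_hd kappa_tl.
Qed.

Lemma keeps_ends_kappa : keeps_ends (fun a => Some (kappa a)).
Proof. by move=> x a [<-]. Qed.

(** Restricting a construction and applying it to restrictions yield different arrow types, which
    [kappa] matches. The lemma serves both direct sums and premutations. *)
Lemma eqv_embedding (S1 : cpalg K Q1) (S : cpalg K Q) :
  commc (S1 - alg_ext (oarr K okappa) S) ->
  eqv (QPair S1) (restriction I (QPair S)).
Proof.
move=> h.
pose r := alg_ext (oarr K okappa); have hr : rhom r := oarr_rhom K keeps_ends_okappa.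
pose k := alg_ext (oarr K (fun a => Some (kappa a))).
have hk : rhom k := oarr_rhom K keeps_ends_kappa.
have rk a : r (arr (kappa a)) = arr a.
  by rewrite /r (oarr_arr _ _ keeps_ends_okappa) /oarr okappa_kappa.
have kk a : k (arr a) = arr (kappa a) by rewrite /k (oarr_arr _ _ keeps_ends_kappa).
have ro (x : Q) : ~~ inI x -> r (arr x) = 0.
  by move=> hx; rewrite /r (oarr_arr _ _ keeps_ends_okappa) /oarr okappa_out.
pose f := rho \o k; pose g := r \o iota Q.
have hf : rhom f := rhom_comp (rho_rhom Q) hk.
have hg : rhom g := rhom_comp hr (iota_rhom Q).
have fr x : f (r x) = rho x.
  apply: (rhom_ext (rhom_comp hf hr) (rho_rhom Q)) => {}x /=.
  have [xI|xI] := boolP (inI x).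
    by have [a <-] := kappa_onto xI; rewrite rk /f /= kk.
  by rewrite ro // (rhom0 hf) rho_arr restrict_arr_out.
exists f, g; split=> //.
- apply: (rhom_ext (rhom_comp hg hf) (@rhom_id _ _ _)) => a /=.
  rewrite /f /= kk rho_arr /restrict_arr insubT ?kappa_hd ?kappa_tl ?kappa_in //.
  by move=> p; rewrite /g /= iota_arr rk.
- by move=> x; rewrite /g /= fr iotaK.
by rewrite /= -fr -rhomB //; exact: rhom_commc.
Qed.

End Embedding.

Section Sum.
Variables T M : qpair K V.

Let kappa (x : sum_quiver (restrict_quiver I (qquiver T))
                          (restrict_quiver I (qquiver M))) :
    sum_quiver (qquiver T) (qquiver M) :=
  match x with inl a => inl (val a) | inr a => inr (val a) end.

Lemma eqv_restriction_sum :
  eqv (direct_sum (restriction I T) (restriction I M))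
      (restriction I (direct_sum T M)).
Proof.
have khd a : hd (kappa a) = hd a by case: a.
have ktl a : tl (kappa a) = tl a by case: a.
have kin (a : sum_quiver (restrict_quiver I (qquiver T))
    (restrict_quiver I (qquiver M))) : inI a by case: a => a; exact: valP a.
have kinj : injective kappa.
  by move=> [a|a] [b|b] // [] /val_inj ->.
apply: (@eqv_embedding _ _ kappa) => //.
- move=> [a|a] aI; first by exists (inl (Sub a aI)).
  by exists (inr (Sub a aI)).
pose r := alg_ext (oarr K (okappa kappa)); rewrite -/r.
have hr : rhom r by exact: oarr_rhom (keeps_ends_okappa khd ktl).
suff -> : r (qpot (direct_sum T M)) = qpot (direct_sum (restriction I T) (restriction I M)).
  by rewrite subrr; exact: commc0.
rewrite /= (rhomD hr).
pose L := alg_ext (oarr K (fun a : qquiver T =>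
  Some (inl a : sum_quiver (qquiver T) (qquiver M)))).
pose R := alg_ext (oarr K (fun a : qquiver M =>
  Some (inr a : sum_quiver (qquiver T) (qquiver M)))).
pose L' := alg_ext (oarr K (fun a : restrict_quiver I (qquiver T) =>
  Some (inl a : sum_quiver (restrict_quiver I (qquiver T))
                           (restrict_quiver I (qquiver M))))).
pose R' := alg_ext (oarr K (fun a : restrict_quiver I (qquiver M) =>
  Some (inr a : sum_quiver (restrict_quiver I (qquiver T))
                           (restrict_quiver I (qquiver M))))).
have rE x : r (arr x) = oarr K (okappa kappa) x.
  exact: oarr_arr (keeps_ends_okappa khd ktl).
have rin a : r (arr (kappa a)) = arr a.
  by rewrite rE /oarr (okappa_kappa kinj).
have rout (x : sum_quiver (qquiver T) (qquiver M)) : ~~ inI x -> r (arr x) = 0.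
  by move=> h; rewrite rE /oarr (okappa_out khd ktl kin h).
have oL : keeps_ends (fun a : qquiver T =>
  Some (inl a : sum_quiver (qquiver T) (qquiver M))) by move=> a b [<-].
have oR : keeps_ends (fun a : qquiver M =>
  Some (inr a : sum_quiver (qquiver T) (qquiver M))) by move=> a b [<-].
have oL' : keeps_ends (fun a : restrict_quiver I (qquiver T) =>
  Some (inl a : sum_quiver (restrict_quiver I (qquiver T))
    (restrict_quiver I (qquiver M)))) by move=> a b [<-].
have oR' : keeps_ends (fun a : restrict_quiver I (qquiver M) =>
  Some (inr a : sum_quiver (restrict_quiver I (qquiver T))
    (restrict_quiver I (qquiver M)))) by move=> a b [<-].
have hL := oarr_rhom K oL; have hR := oarr_rhom K oR.
have hL' := oarr_rhom K oL'; have hR' := oarr_rhom K oR'.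
have eL x : r (L x) = L' (rho x).
  apply: (rhom_ext (rhom_comp hr hL) (rhom_comp hL' (rho_rhom _))) => a /=.
  rewrite rho_arr oarr_arr // {1}/oarr.
  have [aI|aI] := boolP (inI a); last first.
    by rewrite restrict_arr_out // (rhom0 hL') rout.
  rewrite (rin (inl (Sub a aI))) /restrict_arr insubT oarr_arr //.
have eR x : r (R x) = R' (rho x).
  apply: (rhom_ext (rhom_comp hr hR) (rhom_comp hR' (rho_rhom _))) => a /=.
  rewrite rho_arr oarr_arr // {1}/oarr.
  have [aI|aI] := boolP (inI a); last first.
    by rewrite restrict_arr_out // (rhom0 hR') rout.
  rewrite (rin (inr (Sub a aI))) /restrict_arr insubT oarr_arr //.
by congr (_ + _); [exact: eL|exact: eR].
Qed.

End Sum.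

End Restrictions.

(** * Premutation *)

(** The recursion pattern of [bracket_word], which consumes one or two letters at a time. *)
Lemma seq_ind2 (T : Type) (P : seq T -> Prop) :
  P [::] -> (forall a, P [:: a]) ->
  (forall a b w, P w -> P (b :: w) -> P (a :: b :: w)) -> forall w, P w.
Proof.
move=> P0 P1 P2 w; suff [] : P w /\ forall a, P (a :: w) by [].
by elim: w => [|b w [IH1 IH2]]; split=> // a; apply: P2.
Qed.

Lemma prod_eq0 (R : pzRingType) (T : eqType) (F : T -> R) (s : seq T) x :
  x \in s -> F x = 0 -> \prod_(a <- s) F a = 0.
Proof.
move=> xs Fx; elim: s xs => // a s IH; rewrite in_cons big_cons.
by case/orP => [/eqP <-|/IH ->]; rewrite ?Fx ?mul0r ?mulr0.
Qed.

Section Bracket.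
Variables (K : fieldType) (V : finType) (Q : quiver V) (i : V).
Hypothesis Q_lf : loop_free Q.
Local Notation Qt := (premut_quiver i Q).
Local Notation bw := (@bracket_word V i Q).

Lemma bracket_word_hook a b w (h : (tl a == i) && (hd b == i)) :
  bw (a :: b :: w) = inr (Sub (a, b) h : hook i Q) :: bw w.
Proof. by rewrite /= insubT. Qed.

Lemma bracket_word_cons a w : tl a != i -> bw (a :: w) = inl a :: bw w.
Proof.
by case: w => [//|b w] h; rewrite /= insubF //= (negbTE h).
Qed.

Lemma bracket_word_nhook a b w : hd b != i ->
  bw (a :: b :: w) = inl a :: bw (b :: w).
Proof. by move=> h; rewrite /= insubF //= (negbTE h) andbF. Qed.

(** Cutting a word at a vertex other than i never cuts through a hook. *)
Lemma bracket_word_cat w1 b w2 : hd b != i ->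
  bw (w1 ++ b :: w2) = bw w1 ++ bw (b :: w2).
Proof.
move=> hb; elim/seq_ind2: w1 => [//|a|a c w IH1 IH2].
  by rewrite cat1s bracket_word_nhook.
rewrite /=; case: insubP => [ab _ _|_] /=; first by rewrite IH1.
by rewrite -IH2.
Qed.

(** Each output letter replaces at most two input letters; this is what makes the bracket
    continuous. *)
Lemma size_bracket_word w : (size w <= (size (bw w)).*2)%N.
Proof.
elim/seq_ind2: w => // a b w IH1 IH2.
rewrite [bw _]/=; case: insubP => [ab _ _|_]; first exact: IH1.
exact: leq_trans (ltnW IH2).
Qed.

Lemma pcont_bracket :
  pcont (fun p : qpath Q => vert Qt (phead p) * word (bw (pword p)) : cpalg K Qt).
Proof.
move=> n; exists n.*2 => p hp; apply: mpowMr.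
apply: mpowW (@mpow_word _ _ _ _).
by rewrite -leq_double; exact: leq_trans (size_bracket_word _).
Qed.

Lemma bracket_lincont : lincont (@bracket K V i Q).
Proof. exact/path_ext_lincont/pcont_bracket. Qed.

Lemma bracket_pbase v w : is_path v w ->
  bracket (i := i) (pbase K v w) = vert Qt v * word (bw w).
Proof.
move=> pf; exact: (path_ext_pbase (@QPath V Q (v, w) pf) pcont_bracket).
Qed.

(* Extends the bracket to the cycles beginning at i in such a way that a
   rotation changes its value by a commutator only. *)
Definition rot_bracket (v : V) (w : seq Q) : cpalg K Qt :=
  if v == i then (if w is a :: w' then vert Qt (tl a) * word (bw (rcons w' a))
                  else 0)
  else vert Qt v * word (bw w).

Lemma pcont_rot_bracket :
  pcont (fun p : qpath Q => rot_bracket (phead p) (pword p)).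
Proof.
move=> n; exists n.*2 => p hp; rewrite /rot_bracket.
have H v w : (n.*2 <= size w)%N -> mpow n (vert Qt v * word (bw w) : cpalg K Qt).
  move=> hw; apply/mpowMr/(mpowW _ (@mpow_word _ _ _ _)).
  by rewrite -leq_double; exact: leq_trans hw (size_bracket_word _).
case: eqP => _; last exact: H.
rewrite /psize in hp.
case: (pword p) hp => [|a w] hw; first exact: mpow_0.
by apply: H; rewrite size_rcons.
Qed.

(** If v = i both values agree by construction. If a ends at i, then a and the next letter b form a
    hook, and the difference is the commutator of the arrow [ab] with the rest. Otherwise it is the
    commutator of the arrow a with the rest. *)
Lemma rot_bracket_comm v a w : is_path v (a :: w) -> v = word_tail v (a :: w) ->
  comm_sum (rot_bracket v (a :: w) - rot_bracket (tl a) (rcons w a)).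
Proof.
move=> /andP[/eqP hv pf] cyc; rewrite /rot_bracket.
have htl : tl a != v by rewrite -hv eq_sym; exact: Q_lf.
case: (eqVneq v i) => [vi|vi].
  by rewrite -vi (negbTE htl) subrr; exact: comm_sum0.
case: (eqVneq (tl a) i) => [ti|ti].
  case: w pf cyc => [_|b w' /andP[/eqP hb pf] cyc].
    by rewrite /word_tail /= => e; rewrite -e eqxx in htl.
  have hk : (tl a == i) && (hd b == i) by rewrite hb ti eqxx.
  rewrite bracket_word_hook [rcons (b :: _) _]rcons_cons -!cats1 -catA.
  rewrite bracket_word_cat ?hv // bracket_word_hook.
  set u : Qt := inr _; set W := bw w'.
  have -> : vert Qt v * word (u :: W) =
      arr u * (vert Qt (tl b) * word W) :> cpalg K Qt.
    rewrite word_cons !mulrA -[v]hv -[hd a]/(hd u) vert_arr.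
    by rewrite -[tl b]/(tl u) arr_vert.
  have -> : vert Qt (tl b) * word (W ++ u :: bw [::]) =
      vert Qt (tl b) * word W * arr u :> cpalg K Qt.
    by rewrite word_cat word1 mulrA.
  exact: comm_sum_comm.
rewrite bracket_word_cons // -cats1 bracket_word_cat ?hv //.
set u : Qt := inl a; set W := bw w.
have hu : (hd u = hd a) * (tl u = tl a).
  by rewrite /= (negbTE ti) hv (negbTE vi).
have -> : vert Qt v * word (u :: W) =
    arr u * (vert Qt (tl a) * word W) :> cpalg K Qt.
  by rewrite word_cons !mulrA -[v]hv -hu.1 vert_arr -hu.2 arr_vert.
have -> : vert Qt (tl a) * word (W ++ bw [:: a]) =
    vert Qt (tl a) * word W * arr u :> cpalg K Qt.
  by rewrite word_cat word1 mulrA.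
exact: comm_sum_comm.
Qed.

(** Although x has no cycle beginning at i, the rotations that approximate it may pass through such
    cycles. Hence the bracket is first replaced by [rot_bracket], which agrees with it on x and is
    controlled on every rotation. *)
Lemma bracket_commc (x : cpalg K Q) : cyc_equiv x 0 ->
  (forall p, x p != 0 -> phead p != i) -> commc (bracket (i := i) x).
Proof.
rewrite /cyc_equiv subr0 => /madic_closureP hx hi.
have -> : bracket (i := i) x =
    path_ext (fun p => rot_bracket (phead p) (pword p)) x.
  by apply: eq_path_ext => p /hi /negbTE h; rewrite /rot_bracket h.
have lr := path_ext_lincont pcont_rot_bracket.
set B := path_ext _ in lr *; have [BD BZ Bc] := lr.
apply: commc_closed => d; have [N hN] := Bc d.
have [u hu xu] := hx N; exists (B u); last by rewrite -lincontB //; exact: hN.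
move: u hu {xu}; apply: (lin_span_ind (P := fun u => commc (B u))).
- by rewrite lincont0 //; exact: commc0.
- by move=> y z hy hz; rewrite BD; exact: commcD.
- by move=> c y hy; rewrite BZ; exact: commcZ.
move=> _ [p /andP[]] + + ->; move: (path_valP p).
rewrite -/(phead p) -/(pword p) /ptail /psize.
have := path_ext_pbase p pcont_rot_bracket.
case: (pword p) => [//|a w] _ pf _ /eqP cyc.
have hB v t : is_path v t -> B (pbase K v t) = rot_bracket v t.
  move=> pf'.
  exact: (path_ext_pbase (@QPath V Q (v, t) pf') pcont_rot_bracket).
have [/eqP hv pf1] : (hd a == phead p) /\ is_path (tl a) w by exact/andP.
have pf2 : is_path (tl a) (rcons w a).
  rewrite -cats1 is_path_cat pf1 /=; move: cyc; rewrite /word_tail /= => <-.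
  by rewrite hv eqxx.
rewrite rot1_cons; have <- : pbase K (tl a) (rcons w a) = word (rcons w a).
  by case: (w) pf2 => [|b w'] /= pf2; exact: pbase_word.
rewrite -(pbase_word K pf) lincontB // !hB //.
exact/commcW/rot_bracket_comm.
Qed.

End Bracket.

Section PremutationRestriction.
Variables (K : fieldType) (V : finType) (I : {set V}) (Q : quiver V) (i : V).
Hypothesis Q_lf : loop_free Q.
Hypothesis iI : i \in I.
Local Notation QI := (restrict_quiver I Q).
Local Notation rho := (alg_ext (@restrict_arr K _ I Q)).
Local Notation inI a := ((hd a \in I) && (tl a \in I)).

Definition hook_val (w : hook i QI) : hook i Q :=
  Sub (val (val w).1, val (val w).2) (valP w).

Definition premut_val (x : premut_quiver i QI) : premut_quiver i Q :=
  match x with inl c => inl (val c) | inr w => inr (hook_val w) end.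

Lemma premut_val_hd x : hd (premut_val x) = hd x. Proof. by case: x. Qed.
Lemma premut_val_tl x : tl (premut_val x) = tl x. Proof. by case: x. Qed.

Lemma hook_val_inj : injective hook_val.
Proof.
move=> w1 w2 /(congr1 val) /= [e1 e2]; apply: val_inj.
rewrite [LHS]surjective_pairing [RHS]surjective_pairing.
by congr (_, _); apply: val_inj.
Qed.

Lemma premut_val_inj : injective premut_val.
Proof.
move=> [a|a] [b|b] // []; first by move/val_inj ->.
by move=> e1 e2; congr inr; apply: hook_val_inj; apply: val_inj; rewrite /= e1 e2.
Qed.

Lemma premut_inl_in (c : Q) : inI (inl c : premut_quiver i Q) = inI c.
Proof. by rewrite /=; case: ifP; rewrite // andbC. Qed.

(** The place where i lies in I is used: the middle vertex of a hook is i, so if [ab] survives the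
    restriction, so do a and b. *)
Lemma premut_inr_in (w : hook i Q) :
  inI (inr w : premut_quiver i Q) = inI (val w).1 && inI (val w).2.
Proof.
by have /andP[/eqP h1 /eqP h2] := valP w; rewrite h1 h2 iI andbT.
Qed.

Lemma premut_val_in (x : premut_quiver i QI) : inI x.
Proof.
case: x => [c|w] /=.
  by case: ifP => _; have /andP[-> ->] := valP c.
by have /andP[-> _] := valP (val w).1; have /andP[_ ->] := valP (val w).2.
Qed.

Lemma premut_val_onto (x : premut_quiver i Q) : inI x ->
  exists a, premut_val a = x.
Proof.
case: x => [c|w]; first by rewrite premut_inl_in => h; exists (inl (Sub c h)).
rewrite premut_inr_in => /andP[h1 h2].
pose w' : hook i QI :=
  Sub ((Sub (val w).1 h1 : QI), (Sub (val w).2 h2 : QI)) (valP w).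
exists (inr w'); congr inr; apply: val_inj.
by rewrite [RHS]surjective_pairing.
Qed.

Lemma bracket_word_in (w : seq Q) :
  all (fun x => inI x) (bracket_word i w) = all (fun a => inI a) w.
Proof.
elim/seq_ind2: w => [//|a|a b w IH1 IH2].
  by rewrite [bracket_word _ _]/= /all premut_inl_in.
rewrite [bracket_word _ _]/=; case: insubP => [ab _ e|_].
  transitivity (inI (inr ab : premut_quiver i Q) && all (fun c => inI c) w).
    by rewrite -IH1.
  by rewrite premut_inr_in e /= -!andbA.
transitivity (inI (inl a : premut_quiver i Q) && all (fun c => inI c) (b :: w)).
  by rewrite -IH2.
by rewrite premut_inl_in.
Qed.

Lemma bracket_word_val (w : seq QI) :
  bracket_word i (map val w) = map premut_val (bracket_word i w).
Proof.
elim/seq_ind2: w => [//|a //|a b w IH1 IH2].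
rewrite [map _ (a :: _)]/= [bracket_word _ _ in LHS]/= [bracket_word _ _ in RHS]/=.
case: insubP => [ab p e|p]; last by rewrite insubF ?(negbTE p) //= -IH2.
rewrite insubT /= IH1; congr (inr _ :: _); apply: val_inj.
by rewrite e.
Qed.

Let r := alg_ext (oarr K (okappa premut_val)).

Let r_rhom : rhom r.
Proof. exact: oarr_rhom (keeps_ends_okappa premut_val_hd premut_val_tl). Qed.

Let r_arr x : r (arr x) = oarr K (okappa premut_val) x.
Proof. exact: oarr_arr (keeps_ends_okappa premut_val_hd premut_val_tl). Qed.

Let r_val x : r (arr (premut_val x)) = arr x.
Proof. by rewrite r_arr /oarr (okappa_kappa premut_val_inj). Qed.

Let r_out (x : premut_quiver i Q) : ~~ inI x -> r (arr x) = 0.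
Proof.
move=> h; rewrite r_arr /oarr.
by rewrite (okappa_out premut_val_hd premut_val_tl premut_val_in h).
Qed.

(** A bracketed word has a letter outside I exactly when the original word has one, and then both
    sides are 0. *)
Lemma bracket_restriction (x : cpalg K Q) :
  r (bracket (i := i) x) = bracket (i := i) (rho x).
Proof.
have hb Q' := @bracket_lincont K V Q' i.
apply: (lincont_ext (lincont_comp (rhom_lincont r_rhom) (@hb Q))
  (lincont_comp (@hb QI) (rhom_lincont (@rho_rhom K V I Q)))) => v w pf /=.
rewrite bracket_pbase // (rhomM r_rhom) (rhom_vert _ r_rhom) (rhom_word _ r_rhom).
rewrite /pbase (rhomM (@rho_rhom K V I Q)) (rhom_vert _ (@rho_rhom K V I Q)).
rewrite (rhom_word _ (@rho_rhom K V I Q)).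
have [wI|wI] := boolP (all (fun a => inI a) w); last first.
  have /allPn[x0 x0w x0I] : ~~ all (fun x => inI x) (bracket_word i w).
    by rewrite bracket_word_in.
  have /allPn[a0 a0w a0I] := wI.
  rewrite (prod_eq0 x0w) ?r_out // (prod_eq0 a0w).
    by rewrite !mulr0 lincont0.
  by rewrite rho_arr restrict_arr_out.
have [w' ew] : exists w', w = map val (w' : seq QI).
  elim: w {pf} wI => [|a w IH] /=; first by exists [::].
  move=> /andP[aI /IH[w' ->]].
  by exists ((Sub a aI : QI) :: w').
rewrite {w wI}ew in pf *; rewrite bracket_word_val !big_map.
rewrite (eq_bigr (fun a => arr a)) => [|a _]; last exact: r_val.
rewrite [in RHS](eq_bigr (fun a => arr a)) => [|a _]; last first.
  by rewrite rho_arr restrict_arr_val.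
rewrite bracket_pbase //.
by elim: w' v pf => //= a w' IH v /andP[-> /IH].
Qed.

(** The potentials [S1] and [rho S2] come from independent choices of representatives without cycles
    beginning at i, so they can be compared only up to cyclic equivalence. *)
Lemma eqv_premutation_restriction (S1 : cpalg K QI) (S2 : cpalg K Q) :
  potential S1 -> potential S2 ->
  (forall p, S1 p != 0 -> phead p != i) ->
  (forall p, S2 p != 0 -> phead p != i) ->
  commc (S1 - rho S2) ->
  eqv (premutation i (QPair S1)) (restriction I (premutation i (QPair S2))).
Proof.
move=> pS1 pS2 h1 h2 h.
apply: (@eqv_embedding K V I _ _ premut_val premut_val_hd premut_val_tl
  premut_val_inj premut_val_in premut_val_onto).
rewrite -/r (rhomD r_rhom) bracket_restriction (rhom_sum _ _ _ r_rhom).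
set H1 := \sum_w word _; set H2 := \sum_w r _.
(* A hook with [ab] outside I is killed by r through the letter [ab]; the other hooks are those of
   the restricted quiver. *)
have -> : H2 = H1.
  rewrite /H2 (bigID (fun w => inI (inr w : premut_quiver i Q))) /=.
  rewrite addrC big1 ?add0r => [|w hw]; last first.
    rewrite (rhom_word _ r_rhom); apply: (@prod_eq0 _ _ _ _ (inr w)).
      by rewrite !inE eqxx !orbT.
    exact: r_out.
  rewrite (eq_bigl (fun w => w \in [set hook_val w' | w' : hook i QI]%SET)).
    rewrite big_imset => [|w1 w2 _ _]; last exact: hook_val_inj.
    apply: eq_bigr => w _; rewrite (rhom_word _ r_rhom) /word !big_cons !big_nil.
    congr (_ * (_ * (_ * _))); [exact: (r_val (inl (val w).2))|
      exact: (r_val (inl (val w).1))|exact: (r_val (inr w))].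
  move=> w; apply/idP/imsetP => [hw|[w' _ ->]]; last exact: (premut_val_in (inr w')).
  have [[//|w'] [e]] := @premut_val_onto (inr w) hw.
  by exists w'.
rewrite opprD addrACA subrr addr0.
have hb Q' := @bracket_lincont K V Q' i.
rewrite -lincontB //.
apply: bracket_commc.
- by move=> b; exact: (Q_lf (val b)).
- rewrite /cyc_equiv subr0 -/(cyc_equiv _ _); apply: commc_cyc_equiv => //.
  exact: rhom_potential (@rho_rhom K V I Q) pS2.
(* Having no term that begins at i means e_i S = 0, a condition stable under differences and
   homomorphisms. *)
have hh (Q' : quiver V) (S : cpalg K Q') :
    (forall p, S p != 0 -> phead p != i) <-> vert Q' i * S = 0.
  split=> [hS|hS p]; last first.
    rewrite coefE; apply: contra => /eqP e.
    have := congr1 (fun z => coef z (phead p) (pword p)) hS.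
    by rewrite coef_vertM coef0 e eqxx mul1r => ->.
  apply: coef_ext => v w pf; rewrite coef_vertM coef0.
  case: eqP => [e|]; rewrite ?mul0r // mul1r coef_path.
  apply/eqP; apply: contraT => /hS; rewrite /phead /= e eqxx //.
apply/hh; rewrite mulrBr (iffLR (hh _ _) h1) sub0r.
rewrite -(rhom_vert i (@rho_rhom K V I Q)) -(rhomM (@rho_rhom K V I Q)).
by rewrite (iffLR (hh _ _) h2) (rhom0 (@rho_rhom K V I Q)) oppr0.
Qed.

End PremutationRestriction.

(** * Linear parts and quadratic parts *)

Section LinearPart.
Variables (K : fieldType) (V : finType).
Implicit Types Q : quiver V.

Definition lin_coef Q (x : cpalg K Q) (a : Q) : K := coef x (hd a) [:: a].

Lemma lin_coefD Q (x y : cpalg K Q) a : lin_coef (x + y) a = lin_coef x a + lin_coef y a.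
Proof. exact: coefD. Qed.
Lemma lin_coefB Q (x y : cpalg K Q) a : lin_coef (x - y) a = lin_coef x a - lin_coef y a.
Proof. exact: coefB. Qed.
Lemma lin_coefZ Q c (x : cpalg K Q) a : lin_coef (c *: x) a = c * lin_coef x a.
Proof. exact: coefZ. Qed.
Lemma lin_coef0 Q (a : Q) : lin_coef 0 a = 0. Proof. exact: coef0. Qed.
Lemma lin_coef_sum Q (J : Type) (s : seq J) (P : pred J) (F : J -> cpalg K Q) a :
  lin_coef (\sum_(j <- s | P j) F j) a = \sum_(j <- s | P j) lin_coef (F j) a.
Proof. exact: coef_sum. Qed.

Lemma lin_coef_arr Q (a b : Q) : lin_coef (arr a) b = (a == b)%:R.
Proof.
rewrite /lin_coef coef_arr xpair_eqE eqseq_cons andbT [a == b]eq_sym.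
by case: (b =P a) => [->|_]; rewrite ?eqxx ?andbF.
Qed.

Lemma mpow2P Q (x : cpalg K Q) : mpow 1 x -> (forall a, lin_coef x a = 0) -> mpow 2 x.
Proof.
move=> h1 h2 v [|a [|//]] _; first exact: h1.
have [/andP[/eqP <- _]|npf] := boolP (is_path v [:: a]); first exact: h2.
by rewrite coef_npath.
Qed.

Lemma lin_coef_mpow2 Q (x : cpalg K Q) a : mpow 2 x -> lin_coef x a = 0.
Proof. by move=> h; exact: h. Qed.

Lemma rhom_lin_coef_par Q Q' (f : cpalg K Q -> cpalg K Q') a b : rhom f ->
  lin_coef (f (arr a)) b != 0 -> hd b = hd a /\ tl b = tl a.
Proof.
move=> hf; rewrite -(rhom_arr a hf) /lin_coef coef_Mvert coef_vertM.
rewrite !mulf_eq0 !negb_or => /and3P[+ + _].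
rewrite /word_tail /=; case: (tl b =P _) => [->|_]; rewrite ?eqxx // => _.
by case: (hd b =P _) => [->|_]; rewrite ?eqxx.
Qed.

(** The chain rule for linear parts: x differs from its linear part by an element of m^2, whose
    image has no linear part. *)
Lemma lin_coef_rhom Q Q' (f : cpalg K Q -> cpalg K Q') x b : rhom f -> mpow 1 x ->
  lin_coef (f x) b = \sum_a lin_coef x a * lin_coef (f (arr a)) b.
Proof.
move=> hf hx; pose y := \sum_a lin_coef x a *: (arr a : cpalg K Q).
have h : mpow 2 (x - y).
  apply: mpow2P => [|a].
    apply: mpowB => //; apply: mpow_sum => a _; apply: mpowZ.
    exact: mpow_arr.
  rewrite lin_coefB lin_coef_sum (bigD1 a) //= big1 => [|c ca].
    by rewrite lin_coefZ lin_coef_arr eqxx mulr1 addr0 subrr.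
  by rewrite lin_coefZ lin_coef_arr (negbTE ca) mulr0.
have := lin_coef_mpow2 b (rhom_mpow hf h).
rewrite rhomB // lin_coefB => /eqP; rewrite subr_eq0 => /eqP ->.
by rewrite rhom_sum // lin_coef_sum; apply: eq_bigr => a _; rewrite rhomZ // lin_coefZ.
Qed.

Lemma coef_M2 Q (y z : cpalg K Q) a b : mpow 1 y -> mpow 1 z -> tl a = hd b ->
  coef (y * z) (hd a) [:: a; b] = lin_coef y a * lin_coef z b.
Proof.
move=> hy hz e; rewrite coefM /= !big_nat_recl // big_geq // addr0 /=.
rewrite (hy _ [::]) // mul0r add0r /word_tail /= (hz _ [::]) // mulr0 addr0.
by rewrite e.
Qed.

Definition quad Q (t : Q -> Q -> K) : cpalg K Q :=
  \sum_a \sum_b t a b *: (arr a * arr b).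

Definition cyc_supp Q (t : Q -> Q -> K) :=
  forall a b, t a b != 0 -> tl a = hd b /\ tl b = hd a.

Lemma rhom_quad Q Q' (f : cpalg K Q -> cpalg K Q') t : rhom f ->
  f (quad t) = \sum_a \sum_b t a b *: (f (arr a) * f (arr b)).
Proof.
move=> hf; rewrite /quad rhom_sum //; apply: eq_bigr => a _.
by rewrite rhom_sum //; apply: eq_bigr => b _; rewrite rhomZ // (rhomM hf).
Qed.

Lemma coef_rhom_quad Q Q' (f : cpalg K Q -> cpalg K Q') t a' b' : rhom f ->
  tl a' = hd b' -> coef (f (quad t)) (hd a') [:: a'; b'] =
  \sum_a \sum_b t a b * (lin_coef (f (arr a)) a' * lin_coef (f (arr b)) b').
Proof.
move=> hf e; rewrite rhom_quad // coef_sum; apply: eq_bigr => a _.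
rewrite coef_sum; apply: eq_bigr => b _; rewrite coefZ coef_M2 //.
all: by apply: rhom_mpow1 => //; exact: mpow_arr.
Qed.

(** Adding the coefficients of both rotations of a 2-cycle is a linear form that kills every
    rotation generator. It sees paths of length 2 only, so approximation modulo m^3 suffices. *)
Lemma cyc_equiv_coef2 Q (x : cpalg K Q) a b : cyc_equiv x 0 ->
  coef x (hd a) [:: a; b] + coef x (hd b) [:: b; a] = 0.
Proof.
rewrite /cyc_equiv subr0 => /madic_closureP /(_ 3)[u hu xu].
have h v w : (size w < 3)%N -> coef x v w = coef u v w.
  by move=> /(xu v) /eqP; rewrite coefB subr_eq0 => /eqP.
rewrite !h // {h xu}; move: u hu; apply: (lin_span_ind
  (P := fun u => coef u (hd a) [:: a; b] + coef u (hd b) [:: b; a] = 0)).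
- by rewrite !coef0 addr0.
- by move=> y z hy hz; rewrite !coefD addrACA hy hz addr0.
- by move=> c y hy; rewrite !coefZ -mulrDr hy mulr0.
move=> _ [p /andP[]] + + ->; move: (path_valP p).
rewrite -/(phead p) -/(pword p) /ptail /psize.
move: (phead p) (pword p) => v [//|c w] pf _ /eqP cyc.
have H (u : V) (s : seq Q) d e : is_path u s -> s != [::] ->
    coef (word s : cpalg K Q) (hd d) [:: d; e] = (s == [:: d; e])%:R.
  case: s => // k s pf' _; rewrite -(pbase_word K pf') coef_pbase pf' /= xpair_eqE.
  rewrite [LHS](_ : _ = (([:: d; e] == k :: s) && (hd d == u))%:R); last by rewrite andbC.
  rewrite eq_sym; case: eqP => //= -[ed _]; case/andP: pf' => /eqP <- _.
  by rewrite ed eqxx.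
have [/eqP hv pf1] : (hd c == v) /\ is_path (tl c) w by exact/andP.
have pf2 : is_path (tl c) (rcons w c).
  rewrite -cats1 is_path_cat pf1 /=; move: cyc; rewrite /word_tail /= => <-.
  by rewrite hv eqxx.
rewrite rot1_cons !coefB !(H _ _ _ _ pf) // !(H _ _ _ _ pf2) -?size_eq0 ?size_rcons //.
case: w {pf pf1 pf2 cyc} => [|d [|e w]] /=.
- by rewrite !eqseq_cons !andbF subrr addr0.
- rewrite !eqseq_cons !andbT [(d == b) && _]andbC [(d == a) && _]andbC.
  by rewrite addrA subrK subrr.
- by rewrite !eqseq_cons !andbF -!size_eq0 size_rcons !andbF subrr addr0.
Qed.

(** Comparison in degree 2, where x and x' are invisible. The matrices are symmetrized because
    cyclic equivalence determines only the sum over both rotations. *)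
Lemma quad_congruence Q Q' (f : cpalg K Q -> cpalg K Q') t t' x x' : rhom f ->
  cyc_supp t -> cyc_supp t' -> mpow 3 x -> mpow 3 x' ->
  potential (quad t + x) -> potential (quad t' + x') ->
  commc (f (quad t + x) - (quad t' + x')) ->
  forall a' b', \sum_a \sum_b (t a b + t b a) *
    (lin_coef (f (arr a)) a' * lin_coef (f (arr b)) b') = t' a' b' + t' b' a'.
Proof.
move=> hf st st' hx hx' pF pF' h a' b'.
have hid := @rhom_id K V Q'.
(* If a' and b' do not form a 2-cycle, both sides vanish: a nonzero term on the left would come from
   a 2-cycle a, b with a parallel to a' and b to b'. *)
have [cyc|ncyc] := boolP ((tl a' == hd b') && (tl b' == hd a')); last first.
  have nt c d : ~~ ((tl c == hd d) && (tl d == hd c)) -> t' c d = 0.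
    move=> n; apply/eqP; apply: contraT => /st'[e1 e2].
    by rewrite e1 e2 !eqxx in n.
  rewrite !nt ?addr0 // 1?andbC //.
  apply: big1 => a _; apply: big1 => b _; apply/eqP; apply: contraT.
  rewrite !mulf_eq0 !negb_or => /and3P[t0 /(rhom_lin_coef_par hf)[ha ta]].
  move=> /(rhom_lin_coef_par hf)[hb tb]; have e : tl a = hd b /\ tl b = hd a.
    have [t1|t1] := eqVneq (t a b) 0; last exact: st.
    by rewrite t1 add0r in t0; have [-> ->] := st _ _ t0.
  by move: ncyc; rewrite ha ta hb tb e.1 e.2 !eqxx.
case/andP: cyc => /eqP e1 /eqP e2.
have ce := commc_cyc_equiv (rhom_potential hf pF) pF' h.
have := @cyc_equiv_coef2 _ (f (quad t + x) - (quad t' + x')) a' b'.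
rewrite {1}/cyc_equiv subr0 => /(_ ce); rewrite !coefB (rhomD hf) !coefD.
rewrite (rhom_mpow hf hx) // (rhom_mpow hf hx) // !hx' // !addr0.
rewrite !(coef_rhom_quad _ hf) // -[quad t']/(id (quad t')) !(coef_rhom_quad _ hid) //.
have E c d : \sum_a \sum_b t' a b * (lin_coef (arr a) c * lin_coef (arr b) d) = t' c d.
  rewrite (bigD1 c) //= [X in _ + X]big1 ?addr0 => [|e ec]; last first.
    by apply: big1 => b _; rewrite lin_coef_arr (negbTE ec) mul0r mulr0.
  rewrite (bigD1 d) //= big1 ?addr0 => [|e ed].
    by rewrite !lin_coef_arr !eqxx !mulr1.
  by rewrite !lin_coef_arr (negbTE ed) !mulr0.
rewrite !E addrACA -opprD => /eqP; rewrite subr_eq0 => /eqP <-.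
rewrite [X in _ + X]exchange_big -big_split; apply: eq_bigr => a _ /=.
rewrite -big_split; apply: eq_bigr => b _ /=.
by rewrite mulrDl [X in _ + t b a * X]mulrC.
Qed.

End LinearPart.

(** * Uniqueness of the reduced part *)

(** Invertibility of t + t^T: [gamma] is row c of an inverse. *)
Definition nondeg (K : fieldType) (V : finType) (Q : quiver V)
    (t : Q -> Q -> K) :=
  forall c : Q, exists gamma : Q -> K, forall b,
    \sum_a gamma a * (t a b + t b a) = (c == b)%:R.

Section SumQuiver.
Variables (K : fieldType) (V : finType) (C A : quiver V).
Local Notation Q := (sum_quiver C A).

Definition sinl : C -> option Q := fun c => Some (inl c).
Definition sinr : A -> option Q := fun a => Some (inr a).
Definition sprojr : Q -> option A :=
  fun x => match x with inl _ => None | inr a => Some a end.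

Lemma keeps_ends_sinl : keeps_ends sinl. Proof. by move=> a b [<-]. Qed.
Lemma keeps_ends_sinr : keeps_ends sinr. Proof. by move=> a b [<-]. Qed.
Lemma keeps_ends_sprojr : keeps_ends sprojr. Proof. by move=> [a|a] b // [<-]. Qed.

Local Notation jl := (alg_ext (oarr K sinl)).
Local Notation jr := (alg_ext (oarr K sinr)).
Local Notation pr := (alg_ext (oarr K sprojr)).

Lemma jl_rhom : rhom jl. Proof. exact: oarr_rhom keeps_ends_sinl. Qed.
Lemma jr_rhom : rhom jr. Proof. exact: oarr_rhom keeps_ends_sinr. Qed.
Lemma pr_rhom : rhom pr. Proof. exact: oarr_rhom keeps_ends_sprojr. Qed.
Lemma jl_arr c : jl (arr c) = arr (inl c : Q). Proof. exact: oarr_arr keeps_ends_sinl. Qed.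
Lemma jr_arr a : jr (arr a) = arr (inr a : Q). Proof. exact: oarr_arr keeps_ends_sinr. Qed.
Lemma pr_inl c : pr (arr (inl c : Q)) = 0. Proof. exact: oarr_arr keeps_ends_sprojr. Qed.
Lemma pr_inr a : pr (arr (inr a : Q)) = arr a. Proof. exact: oarr_arr keeps_ends_sprojr. Qed.

Definition textend (t : C -> C -> K) (x y : Q) : K :=
  match x, y with inl a, inl b => t a b | _, _ => 0 end.

Lemma jl_quad t : jl (quad t) = quad (textend t).
Proof.
rewrite (rhom_quad _ jl_rhom) /quad big_sumType /= [X in _ + X]big1 ?addr0.
  apply: eq_bigr => a _; rewrite big_sumType /= [X in _ + X]big1 ?addr0.
    by apply: eq_bigr => b _; rewrite !jl_arr.
  by move=> b _; rewrite scale0r.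
by move=> a _; apply: big1 => b _; rewrite scale0r.
Qed.

Lemma cyc_supp_textend t : cyc_supp t -> cyc_supp (textend t).
Proof. by move=> st [a|a] [b|b] /=; rewrite ?eqxx //; exact: st. Qed.

End SumQuiver.

Arguments sinl {V} C A.
Arguments sinr {V} C A.
Arguments sprojr {V} C A.

Definition forward (V : finType) (Q : quiver V) (a : Q) : bool :=
  (enum_rank (hd a) < enum_rank (tl a))%N.

Lemma forward_cycle (V : finType) (Q : quiver V) (a b : Q) : loop_free Q ->
  tl a = hd b -> tl b = hd a -> forward b = ~~ forward a.
Proof.
move=> lf e1 e2; rewrite /forward -e1 e2 -leqNgt [RHS]leq_eqVlt.
case: eqP => [/ord_inj/enum_rank_inj e|//].
by move: (lf a); rewrite e eqxx.
Qed.

Section LinearBlock.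
Variables (K : fieldType) (V : finType) (C A C' A' : quiver V).
Local Notation Q := (sum_quiver C A).
Local Notation Q' := (sum_quiver C' A').
Local Notation jl C A := (alg_ext (oarr K (sinl C A))).
Local Notation jr C A := (alg_ext (oarr K (sinr C A))).

(* For P the matrix of the linear part of f, quad_congruence says that
   P^T tau P = tau'.  As P is invertible, tau P vanishes on the columns of A',
   and tau is invertible on C. *)
Lemma linear_block t S t' S' (f : cpalg K Q -> cpalg K Q')
    (g : cpalg K Q' -> cpalg K Q) :
  rhom f -> rhom g -> cancel f g ->
  cyc_supp t -> nondeg t -> cyc_supp t' -> mpow 3 S -> mpow 3 S' ->
  potential (jl C A (quad t) + jr C A S) ->
  potential (jl C' A' (quad t') + jr C' A' S') ->
  commc (f (jl C A (quad t) + jr C A S) -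
    (jl C' A' (quad t') + jr C' A' S')) ->
  forall c a', lin_coef (f (arr (inl c : Q))) (inr a' : Q') = 0.
Proof.
move=> hf hg fK st nt st' hS hS' pF pF' h c a'.
have hS2 := rhom_mpow (jr_rhom K C A) hS.
have hS2' := rhom_mpow (jr_rhom K C' A') hS'.
rewrite !jl_quad in pF pF' h.
have H := quad_congruence hf (cyc_supp_textend (A := A) st)
  (cyc_supp_textend (A := A') st') hS2 hS2' pF pF' h.
pose P x y' := lin_coef (f (arr (x : Q))) (y' : Q').
pose R x' y := lin_coef (g (arr (x' : Q'))) (y : Q).
pose tau (x y : Q) := textend t x y + textend t y x.
have PR x z : \sum_x' P x x' * R x' z = (x == z)%:R.
  rewrite -lin_coef_arr -[arr x](fK (arr x)) (lin_coef_rhom _ hg) //.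
  by apply: (rhom_mpow1 hf); exact: mpow_arr.
have E z : \sum_y tau z y * P y (inr a') = 0.
  transitivity (\sum_x' R x' z *
      \sum_x \sum_y tau x y * (P x x' * P y (inr a'))); last first.
    apply: big1 => x' _; rewrite H; case: x' => x' /=; rewrite ?addr0 ?mulr0 //.
  under [RHS]eq_bigr => x' _ do rewrite mulr_sumr.
  rewrite exchange_big /=.
  transitivity (\sum_x (x == z)%:R * \sum_y tau x y * P y (inr a')).
    rewrite [RHS](bigD1 z) //= eqxx mul1r [X in _ + X]big1 ?addr0 // => x xz.
    by rewrite (negbTE xz) mul0r.
  apply: eq_bigr => x _; rewrite -PR mulr_suml; apply: eq_bigr => x' _.
  rewrite !mulr_sumr; apply: eq_bigr => y _.
  by rewrite [P x x' * R _ _]mulrC -!mulrA; congr (_ * _); rewrite mulrCA.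
have [gam hgam] := nt c.
transitivity (\sum_a gam a * \sum_y tau (inl a) y * P y (inr a')); last first.
  by apply: big1 => a _; rewrite E mulr0.
transitivity (\sum_b (c == b)%:R * P (inl b) (inr a')).
  rewrite (bigD1 c) //= eqxx mul1r big1 ?addr0 // => b bc.
  by rewrite eq_sym (negbTE bc) mul0r.
have E2 a : gam a * \sum_y tau (inl a) y * P y (inr a') =
    \sum_b gam a * ((t a b + t b a) * P (inl b) (inr a')).
  rewrite big_sumType /= [X in _ + X]big1 ?addr0 ?mulr_sumr // => b _.
  by rewrite /tau /= addr0 mul0r.
rewrite (eq_bigr _ (fun a _ => E2 a)).
rewrite exchange_big; apply: eq_bigr => b _ /=.
by rewrite -hgam mulr_suml; apply: eq_bigr => a _; rewrite mulrA.
Qed.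

End LinearBlock.

Section Uniqueness.
Variables (K : fieldType) (V : finType) (C A C' A' : quiver V).
Local Notation Q := (sum_quiver C A).
Local Notation Q' := (sum_quiver C' A').
Local Notation jl C A := (alg_ext (oarr K (sinl C A))).
Local Notation jr C A := (alg_ext (oarr K (sinr C A))).
Local Notation pr C A := (alg_ext (oarr K (sprojr C A))).
Variables (t : C -> C -> K) (t' : C' -> C' -> K).
Variables (S : cpalg K A) (S' : cpalg K A').
Variables (f : cpalg K Q -> cpalg K Q') (g : cpalg K Q' -> cpalg K Q).
Hypotheses (hf : rhom f) (hg : rhom g) (fK : cancel f g) (gK : cancel g f).
Hypotheses (lfC : loop_free C) (lfC' : loop_free C').
Hypotheses (st : cyc_supp t) (nt : nondeg t).
Hypotheses (st' : cyc_supp t') (nt' : nondeg t').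
Hypotheses (hS : mpow 3 S) (hS' : mpow 3 S').
Local Notation F := (jl C A (quad t) + jr C A S).
Local Notation F' := (jl C' A' (quad t') + jr C' A' S').
Hypotheses (pF : potential F) (pF' : potential F').
Hypothesis fF : commc (f F - F').

Let P x y' := lin_coef (f (arr (x : Q))) (y' : Q').
Let R x' y := lin_coef (g (arr (x' : Q'))) (y : Q).

Let P_block c a' : P (inl c) (inr a') = 0.
Proof. exact: linear_block hf hg fK st nt st' hS hS' pF pF' fF c a'. Qed.

Let R_block c' a : R (inl c') (inr a) = 0.
Proof.
apply: (linear_block hg hf gK st' nt' st hS' hS pF' pF).
rewrite -[in X in _ - X](fK F) -(rhomB hg) -opprB.
by apply: rhom_commc => //; exact: commcN.
Qed.

Let PR x z : \sum_x' P x x' * R x' z = (x == z)%:R.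
Proof.
rewrite -lin_coef_arr -[arr x](fK (arr x)) (lin_coef_rhom _ hg) //.
by apply: (rhom_mpow1 hf); exact: mpow_arr.
Qed.

Let RP x z : \sum_x' R x x' * P x' z = (x == z)%:R.
Proof.
rewrite -lin_coef_arr -[arr x](gK (arr x)) (lin_coef_rhom _ hf) //.
by apply: (rhom_mpow1 hg); exact: mpow_arr.
Qed.

(** By [P_block] this is the whole linear part of the image of c under f. *)
Let lin (c : C) : cpalg K Q' := \sum_c' P (inl c) (inl c') *: arr (inl c' : Q').

Let lin_mpow c : mpow 1 (lin c).
Proof.
by apply: mpow_sum => c' _; apply: mpowZ; exact: mpow_arr.
Qed.

Let lin_coef_lin c y' : lin_coef (lin c) y' = P (inl c) y'.
Proof.
rewrite lin_coef_sum; case: y' => [c'|a'].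
  rewrite (bigD1 c') //= big1 ?addr0 => [|d dc].
    by rewrite lin_coefZ lin_coef_arr eqxx mulr1.
  by rewrite lin_coefZ lin_coef_arr (inj_eq inl_inj) (negbTE dc) mulr0.
by rewrite P_block big1 // => d _; rewrite lin_coefZ lin_coef_arr mulr0.
Qed.

Let lin_vert c : vert Q' (hd c) * lin c * vert Q' (tl c) = lin c.
Proof.
rewrite /lin mulr_sumr mulr_suml; apply: eq_bigr => c' _.
rewrite scalerArc scalerAlc.
have [->|/(rhom_lin_coef_par hf)[e1 e2]] := eqVneq (P (inl c) (inl c')) 0.
  by rewrite !scale0r.
by rewrite -[hd c]e1 -[tl c]e2 vert_arr arr_vert.
Qed.

(* The change of coordinates in which the subspace X of the header is cut out by
   the arrows of C: a forward arrow c stands for itself and a backward one for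
   the linear part of f c, pulled back by g. *)
Let gmap (x : Q) : cpalg K Q :=
  match x with
  | inl c => if forward c then arr (inl c : Q) else g (lin c)
  | inr a => arr (inr a : Q)
  end.

Let end_compatible_gmap : end_compatible gmap.
Proof.
have arr_adm (x : Q) : mpow 1 (arr x : cpalg K Q) /\
    vert Q (hd x) * arr x * vert Q (tl x) = arr x :> cpalg K Q.
  by split; [exact: mpow_arr|rewrite vert_arr arr_vert].
case=> [c|a]; last exact: (arr_adm (inr a)).
rewrite /gmap; case: ifP => _; first exact: (arr_adm (inl c)).
split; first by apply: rhom_mpow1 => //; exact: lin_mpow.
by rewrite -!(rhom_vert _ hg) -!(rhomM hg) lin_vert.
Qed.

Let u := alg_ext gmap.
Let u_rhom : rhom u. Proof. exact: alg_ext_rhom. Qed.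
Let u_arr x : u (arr x) = gmap x. Proof. exact: alg_ext_arr. Qed.

(** For a backward c write c = g (f c): the difference is g applied to [lin c] - f c, which lies in
    m^2. *)
Let u_close x : mpow 2 (u (arr x) - arr x).
Proof.
rewrite u_arr; case: x => [c|a] /=; last by rewrite subrr; exact: mpow_0.
case: ifP => _; first by rewrite subrr; exact: mpow_0.
rewrite -[arr (inl c : Q)](fK (arr _)) -rhomB //; apply: rhom_mpow => //.
apply: mpow2P => [|y'].
  by apply: mpowB => //; apply: rhom_mpow1 => //; exact: mpow_arr.
by rewrite lin_coefB lin_coef_lin subrr.
Qed.

Lemma eqv_reduced : eqv (QPair S) (QPair S').
Proof.
have [v uK vK] := endo_bij u_rhom u_close.
have hv := rhom_inv uK vK u_rhom.
have hp := pr_rhom K C A; have hp' := pr_rhom K C' A'.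
(* Restriction of functions to X, expressed in the coordinates A. *)
pose alpha := pr C A \o v.
have ha : rhom alpha := rhom_comp hp hv.
have alpha_inr a : alpha (arr (inr a : Q)) = arr a.
  by rewrite /alpha /= -[arr (inr a : Q)]/(gmap (inr a)) -u_arr uK pr_inr.
have alpha_fwd c : forward c -> alpha (arr (inl c : Q)) = 0.
  move=> fc; have e : u (arr (inl c : Q)) = arr (inl c : Q) by rewrite u_arr /= fc.
  by rewrite /alpha /= -{1}e uK pr_inl.
have alpha_lin c : ~~ forward c -> alpha (g (lin c)) = 0.
  move=> fc; have e : u (arr (inl c : Q)) = g (lin c) by rewrite u_arr /= (negbTE fc).
  by rewrite /alpha /= -e uK pr_inl.
have RPll c' d' :
    \sum_c R (inl c') (inl c) * P (inl c) (inl d') = (c' == d')%:R.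
  have := RP (inl c') (inl d'); rewrite big_sumType /= [X in _ + X]big1.
    by rewrite addr0 (inj_eq inl_inj).
  by move=> a _; rewrite R_block mul0r.
(* The C-blocks of R and P are mutually inverse, so c' is a combination of the [lin c]. Those that
   occur have c parallel to c', hence backward, and vanish on X. *)
have alpha_bwd c' : ~~ forward c' -> alpha (g (arr (inl c' : Q'))) = 0.
  move=> fc'; have -> : arr (inl c' : Q') = \sum_c R (inl c') (inl c) *: lin c.
    under eq_bigr => c _ do rewrite /lin scaler_sumr.
    rewrite exchange_big /= (bigD1 c') //= [X in _ + X]big1 ?addr0.
      under eq_bigr => c _ do rewrite scalerA.
      by rewrite -scaler_suml RPll eqxx scale1r.
    move=> d' dc'; under eq_bigr => c _ do rewrite scalerA.
    by rewrite -scaler_suml RPll eq_sym (negbTE dc') scale0r.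
  rewrite (rhom_sum _ _ _ hg) (rhom_sum _ _ _ ha) big1 // => c _.
  rewrite rhomZ // rhomZ //.
  have [->|/(rhom_lin_coef_par hg)[e1 e2]] := eqVneq (R (inl c') (inl c)) 0.
    by rewrite scale0r.
  rewrite alpha_lin ?scaler0 //; move: fc'; rewrite /forward.
  by rewrite -[hd c']e1 -[tl c']e2.
have alpha_close x a : lin_coef (alpha (arr x)) a = (x == inr a)%:R.
  have hm : mpow 1 (v (arr x)) by apply: rhom_mpow1 => //; exact: mpow_arr.
  have := rhom_close u_rhom (@rhom_id _ _ _) u_close hm.
  rewrite vK => /(rhom_mpow hp) /(lin_coef_mpow2 a); rewrite (rhomB hp) lin_coefB.
  move=> /eqP; rewrite subr_eq0 => /eqP <-.
  by case: x {hm} => [c|b]; rewrite ?pr_inl ?lin_coef0 // pr_inr lin_coef_arr (inj_eq inr_inj).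
have alphaF : alpha F = S.
  rewrite (rhomD ha) -[RHS]add0r; congr (_ + _).
    rewrite -[alpha _]/((alpha \o jl C A) _).
    rewrite (rhom_quad _ (rhom_comp ha (jl_rhom K C A))).
    apply: big1 => c _; apply: big1 => d _ /=; rewrite !jl_arr.
    have [->|/st[e1 e2]] := eqVneq (t c d) 0; first by rewrite scale0r.
    have [fc|fc] := boolP (forward c).
      by rewrite alpha_fwd // mul0r scaler0.
    by rewrite [alpha (arr (inl d : Q))]alpha_fwd ?mulr0 ?scaler0 //
      (forward_cycle lfC e1 e2).
  apply: (rhom_ext (rhom_comp ha (jr_rhom K C A)) (@rhom_id _ _ _)) => a /=.
  by rewrite jr_arr alpha_inr.
(* The coordinates A' restricted to X and expressed in the coordinates A. *)
pose psi := alpha \o g \o jr C' A'.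
have hpsi : rhom psi := rhom_comp (rhom_comp ha hg) (jr_rhom K C' A').
have alphaF' : alpha (g F') = psi S'.
  rewrite (rhomD hg) (rhomD ha) -[RHS]add0r; congr (_ + _).
  rewrite -[alpha _]/((alpha \o g \o jl C' A') _).
  rewrite (rhom_quad _ (rhom_comp (rhom_comp ha hg) (jl_rhom K C' A'))).
  apply: big1 => c _; apply: big1 => d _ /=; rewrite !jl_arr.
  have [->|/st'[e1 e2]] := eqVneq (t' c d) 0; first by rewrite scale0r.
  have [fc|fc] := boolP (forward c); last first.
    by rewrite alpha_bwd // mul0r scaler0.
  by rewrite [alpha (g (arr (inl d : Q')))]alpha_bwd ?mulr0 ?scaler0 //
    (forward_cycle lfC' e1 e2) fc.
(* Only a candidate for the inverse of [psi] up to first order. Its linear part is the A-block of P,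
   which is inverse to the A-block of R since the mixed blocks [P_block] and [R_block] vanish. *)
pose chi := pr C' A' \o f \o jr C A.
have hchi : rhom chi := rhom_comp (rhom_comp hp' hf) (jr_rhom K C A).
have lin_coef_psi a' a : lin_coef (psi (arr a')) a = R (inr a') (inr a).
  rewrite /psi /= jr_arr (lin_coef_rhom _ ha); last first.
    by apply: rhom_mpow1 => //; exact: mpow_arr.
  rewrite (bigD1 (inr a)) //= big1 ?addr0 => [|x xa].
    by rewrite alpha_close eqxx mulr1.
  by rewrite alpha_close (negbTE xa) mulr0.
have lin_coef_chi a a' : lin_coef (chi (arr a)) a' = P (inr a) (inr a').
  rewrite /chi /= jr_arr (lin_coef_rhom _ hp'); last first.
    by apply: rhom_mpow1 => //; exact: mpow_arr.
  rewrite (bigD1 (inr a')) //= big1 ?addr0 => [|[c|b] xa].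
  - by rewrite pr_inr lin_coef_arr eqxx mulr1.
  - by rewrite pr_inl lin_coef0 mulr0.
  - by rewrite (inj_eq inr_inj) in xa; rewrite pr_inr lin_coef_arr (negbTE xa) mulr0.
have [psi' [hpsi' psiK psi'K]] : exists psi',
    [/\ rhom psi', cancel psi psi' & cancel psi' psi].
  apply: (rhom_bij hpsi hchi) => [a'|a].
    apply: mpow2P => [|b'].
      apply: mpowB; last exact: mpow_arr.
      by do 2!apply: rhom_mpow1 => //; exact: mpow_arr.
    rewrite lin_coefB lin_coef_arr (lin_coef_rhom _ hchi); last first.
      by apply: rhom_mpow1 => //; exact: mpow_arr.
    under eq_bigr => a _ do rewrite lin_coef_psi lin_coef_chi.
    have := RP (inr a') (inr b'); rewrite big_sumType /= big1 ?add0r => [->|c _].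
      by rewrite subrr.
    by rewrite P_block mulr0.
  apply: mpow2P => [|b].
    apply: mpowB; last exact: mpow_arr.
    by do 2!apply: rhom_mpow1 => //; exact: mpow_arr.
  rewrite lin_coefB lin_coef_arr (lin_coef_rhom _ hpsi); last first.
    by apply: rhom_mpow1 => //; exact: mpow_arr.
  under eq_bigr => a' _ do rewrite lin_coef_psi lin_coef_chi.
  have := PR (inr a) (inr b); rewrite big_sumType /= big1 ?add0r => [->|c _].
    by rewrite subrr.
  by rewrite R_block mulr0.
(* Applying [alpha] after g to the equivalence f F ~ F' gives S ~ psi S'. As [psi] goes from A' to
   A, its inverse is the equivalence sought. *)
exists psi', psi; split=> //.
have := rhom_commc ha (rhom_commc hg fF).
rewrite (rhomB hg) fK (rhomB ha) alphaF alphaF' => /(rhom_commc hpsi').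
by rewrite rhomB // psiK.
Qed.

End Uniqueness.

(** * Trivial potentials as nondegenerate quadratic forms, and their restrictions *)

Section TrivialPart.
Variables (K : fieldType) (V : finType).
Implicit Types Q : quiver V.

Lemma coef_arr2 Q (a b : Q) v w : coef (arr a * arr b : cpalg K Q) v w =
  ((tl a == hd b) && ((v, w) == (hd a, [:: a; b])))%:R.
Proof.
rewrite coef_arrM; case: w => [|c w]; first by rewrite xpair_eqE !andbF.
rewrite coef_arr !xpair_eqE eqseq_cons -natrM mulnb; congr ((nat_of_bool _)%:R).
by case: (v == hd a); case: (c == a); rewrite /= ?andbF.
Qed.

Lemma pcont_cyc_deriv Q (a : Q) :
  pcont (fun p : qpath Q => if is_cycle p then cyc_deriv_word K a (pword p) else 0).
Proof.
move=> n; exists n.+1 => p hp; case: ifP => _; last exact: mpow_0.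
apply: mpow_sum => s _; apply: mpowW (@mpow_word _ _ _ _).
rewrite size_cat size_drop size_takel ?(ltnW (ltn_ord s)) //.
by rewrite subnS -subn1 addnC addnBA ?subn_gt0 // subnKC ?(ltnW (ltn_ord s)) //
  leq_subRL // (leq_trans _ hp).
Qed.

Lemma cyc_deriv_word2 Q (a x y : Q) : cyc_deriv_word K a [:: x; y] =
  (x == a)%:R *: arr y + (y == a)%:R *: arr x.
Proof.
rewrite /cyc_deriv_word big_mkcond !big_ord_recl big_ord0 /= addr0.
rewrite !(inj_eq (@Some_inj _)) !word1.
by congr (_ + _); case: eqP; rewrite ?scale1r ?scale0r.
Qed.

(** Thus the cyclic derivatives of a quadratic potential are the rows of t + t^T, and triviality
    says that these rows span everything. *)
Lemma lin_coef_cyc_deriv Q t (a b : Q) : loop_free Q -> cyc_supp t ->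
  lin_coef (cyc_deriv a (quad t)) b = t a b + t b a :> K.
Proof.
move=> lf st; have hc : lincont (@cyc_deriv K V Q a).
  exact: path_ext_lincont (pcont_cyc_deriv a).
have [_ cZ _] := hc.
have E x y : lin_coef (cyc_deriv a (t x y *: (arr x * arr y))) b =
    t x y * ((x == a)%:R * (y == b)%:R + (y == a)%:R * (x == b)%:R).
  rewrite cZ lin_coefZ.
  have [->|/st[e1 e2]] := eqVneq (t x y) 0; first by rewrite !mul0r.
  have pf : is_path (hd x) [:: x; y] by rewrite /= e1 !eqxx.
  have -> : arr x * arr y = pbase K (hd x) [:: x; y].
    by rewrite pbase_word // word_cons word1.
  have -> : cyc_deriv a (pbase K (hd x) [:: x; y]) = _ :=
    path_ext_pbase (@QPath V Q (hd x, [:: x; y]) pf) (pcont_cyc_deriv a).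
  rewrite ifT; last by rewrite /is_cycle /ptail /phead /= /word_tail /= e2.
  by rewrite cyc_deriv_word2 lin_coefD !lin_coefZ !lin_coef_arr.
rewrite /quad (lincont_sum _ _ _ hc) lin_coef_sum.
under eq_bigr => x _ do rewrite (lincont_sum _ _ _ hc) lin_coef_sum.
under eq_bigr => x _ do under eq_bigr => y _ do rewrite E mulrDr.
under eq_bigr => x _ do rewrite big_split /=.
rewrite big_split /=; congr (_ + _).
  rewrite (bigD1 a) //= [X in _ + X]big1 ?addr0 => [|x xa]; last first.
    by apply: big1 => y _; rewrite (negbTE xa) mul0r mulr0.
  rewrite (bigD1 b) //= big1 ?addr0 ?eqxx ?mulr1 // => y yb.
  by rewrite (negbTE yb) !mulr0.
rewrite (bigD1 b) //= [X in _ + X]big1 ?addr0 => [|x xa]; last first.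
  by apply: big1 => y _; rewrite (negbTE xa) !mulr0.
rewrite (bigD1 a) //= big1 ?addr0 ?eqxx ?mulr1 // => y yb.
by rewrite (negbTE yb) mul0r mulr0.
Qed.

(** The matrix form of triviality, convenient because it passes directly to restrictions. *)
Definition nondeg_quad (T : qpair K V) := exists t,
  [/\ qpot T = quad t, cyc_supp t & nondeg t].

Lemma trivial_nondeg (T : qpair K V) :
  is_qp T -> trivial_qp T -> nondeg_quad T.
Proof.
case: T => Q T [/= lf pT _] [/= size2 span].
pose t a b := coef T (hd a) [:: a; b].
have st : cyc_supp t.
  move=> a b; rewrite /t; have [pf|npf] := boolP (is_path (hd a) [:: a; b]).
    rewrite coef_path => /pT /andP[_ /eqP]; rewrite /ptail /phead /= /word_tail /=.
    by move: pf; rewrite /= => /and3P[_ /eqP -> _] ->.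
  by rewrite coef_npath ?eqxx.
have Tq : T = quad t.
  apply: coef_ext => v w pf; rewrite coef_sum.
  have H a b : coef (t a b *: (arr a * arr b)) v w = t a b * (w == [:: a; b])%:R.
    rewrite coefZ; have [->|/st[e1 e2]] := eqVneq (t a b) 0; first by rewrite !mul0r.
    rewrite coef_arr2 e1 eqxx xpair_eqE /=; case: (w =P _) => [ew|]; last by rewrite andbF.
    by move: pf; rewrite ew /= => /andP[/eqP -> _]; rewrite eqxx.
  under eq_bigr => a _ do (rewrite coef_sum; under eq_bigr => b _ do rewrite H).
  have [h2|h2] := eqVneq (size w) 2%N; last first.
    rewrite coef_path; set q := QPath _; have [->|/size2] := eqVneq (T q) 0; last first.
      by rewrite /psize /pword /= => e; rewrite e eqxx in h2.
    symmetry; apply: big1 => a _; apply: big1 => b _.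
    by case: eqP => [e|]; rewrite ?mulr0 //; rewrite e eqxx in h2.
  case: w {H} pf h2 => [|a [|b []]] //= /andP[/eqP <- _] _.
  rewrite (bigD1 a) //= [X in _ + X]big1 ?addr0 => [|c ca]; last first.
    by apply: big1 => d _; rewrite !eqseq_cons (eq_sym a) (negbTE ca) mulr0.
  rewrite (bigD1 b) //= big1 ?addr0 ?eqxx ?mulr1 // => d db.
  by rewrite !eqseq_cons (eq_sym b) (negbTE db) !andbF mulr0.
exists t; split=> // c.
have : lin_span (range (fun a : Q => cyc_deriv a T)) (arr c).
  by rewrite span; apply: lin_span_gen; exists c.
have H : forall x, lin_span (range (fun a : Q => cyc_deriv a T)) x ->
    exists gamma : Q -> K, forall b, \sum_a gamma a * (t a b + t b a) = lin_coef x b.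
  apply: lin_span_ind.
  - by exists (fun=> 0) => b; rewrite lin_coef0; apply: big1 => a _; rewrite mul0r.
  - move=> x y [g1 h1] [g2 h2]; exists (fun a => g1 a + g2 a) => b.
    by rewrite lin_coefD -h1 -h2 -big_split; apply: eq_bigr => a _; rewrite mulrDl.
  - move=> k x [g h]; exists (fun a => k * g a) => b.
    by rewrite lin_coefZ -h mulr_sumr; apply: eq_bigr => a _; rewrite mulrA.
  move=> _ [a _ <-]; exists (fun a' => (a == a')%:R) => b.
  rewrite Tq lin_coef_cyc_deriv // (bigD1 a) //= eqxx mul1r big1 ?addr0 // => a' aa'.
  by rewrite eq_sym (negbTE aa') mul0r.
by move=> /H[gamma hg]; exists gamma => b; rewrite hg lin_coef_arr.
Qed.

Variable I : {set V}.

Lemma sum_restrict Q (R : nmodType) (F : Q -> R) :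
  (forall a, ~~ ((hd a \in I) && (tl a \in I)) -> F a = 0) ->
  \sum_a F a = \sum_(b : restrict_quiver I Q) F (val b).
Proof.
move=> h; rewrite (bigID (fun a => (hd a \in I) && (tl a \in I))) /=.
rewrite [X in _ + X]big1 ?addr0 //.
rewrite (eq_bigl (fun a => a \in [set val b | b : restrict_quiver I Q]%SET)).
  by rewrite big_imset // => b1 b2 _ _; exact: val_inj.
move=> a; apply/idP/imsetP => [aI|[b _ ->]]; last exact: valP b.
by exists (Sub a aI).
Qed.

(** The partner of an arrow of I in a 2-cycle has the same two ends, so it lies in I as well. Hence
    t + t^T is block diagonal and the rows of its inverse can be restricted. *)
Lemma nondeg_quad_restriction (T : qpair K V) :
  nondeg_quad T -> nondeg_quad (restriction I T).
Proof.
case: T => Q T [t [/= -> st nt]].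
exists (fun a b => t (val a) (val b)); split=> [|a b|c]; last 2 first.
- exact: st.
- have [gamma hg] := nt (val c); exists (fun a => gamma (val a)) => b.
  rewrite -(inj_eq val_inj) -hg [RHS]sum_restrict // => a aI.
  have -> : t a (val b) + t (val b) a = 0; last by rewrite mulr0.
  have /andP[b1 b2] := valP b.
  have [e|/st[e1 e2]] := eqVneq (t a (val b)) 0; last first.
    by rewrite e1 -e2 b1 b2 in aI.
  rewrite e add0r; have [//|/st[e1 e2]] := eqVneq (t (val b) a) 0.
  by rewrite -e1 e2 b1 b2 in aI.
rewrite /= (rhom_quad _ (@rho_rhom K V I Q)) sum_restrict => [|a aI]; last first.
  by apply: big1 => b _; rewrite rho_arr restrict_arr_out // mul0r scaler0.
apply: eq_bigr => a _; rewrite sum_restrict => [|b bI]; last first.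
  by rewrite (rho_arr K I b) (@restrict_arr_out K V I Q b) // mulr0 scaler0.
by apply: eq_bigr => b _; rewrite !rho_arr !restrict_arr_val.
Qed.

(** Degree 1 is excluded because a cycle of length 1 is a loop. *)
Lemma reduced_mpow3 (M : qpair K V) : is_qp M -> reduced_qp M -> mpow 3 (qpot M).
Proof.
case: M => Q S [/= lf pS _] red v w hw.
have [pf|npf] := boolP (is_path v w); last by rewrite coef_npath.
rewrite coef_path; apply/eqP; apply: contraT => nz.
have := pS _ nz; rewrite /is_cycle /psize /pword /phead /ptail /=.
case: w hw pf nz => [//|a [|b [|//]]] _ pf nz.
  move=> /eqP; move: (pf); rewrite /word_tail /= => /andP[/eqP <- _] e.
  by move: (lf a); rewrite e eqxx.
by move=> _; case/eqP: nz; exact: red.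
Qed.

Lemma eqv_reduced_part (T N T' N' : qpair K V) :
  loop_free (qquiver T) -> loop_free (qquiver T') ->
  nondeg_quad T -> nondeg_quad T' ->
  potential (qpot T) -> potential (qpot T') ->
  potential (qpot N) -> potential (qpot N') ->
  mpow 3 (qpot N) -> mpow 3 (qpot N') ->
  eqv (direct_sum T N) (direct_sum T' N') -> eqv N N'.
Proof.
case: T => C T; case: N => A S; case: T' => C' T'; case: N' => A' S' /=.
move=> lf lf' [t [/= -> st nt]] [t' [/= -> st' nt']] pT pT' pS pS' hS hS'.
move=> [f [g [hf hg fK gK h]]].
apply: (eqv_reduced hf hg fK gK lf lf' st nt st' nt' hS hS') => //.
  by apply: potentialD; apply: rhom_potential => //;
    [exact: jl_rhom|exact: jr_rhom].
by apply: potentialD; apply: rhom_potential => //;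
  [exact: jl_rhom|exact: jr_rhom].
Qed.

End TrivialPart.

Theorem proposition21 (K : fieldType) (V : finType) (P : qpair K V)
    (I : {set V}) (i : V) :
  is_qp P -> i \in I -> no_2cycle_at (qquiver P) i ->
  forall N M : qpair K V,
    is_mutation i (restriction I P) N -> is_mutation i P M ->
    right_equiv N (restriction I M).
Proof.
move=> [lfP pP _] iI _ N M [S1 [pS1 eS1 hS1 [qpN redN [T [qpT trT]]]]].
move=> /right_equiv_eqv eT [S2 [pS2 eS2 hS2 [qpM redM [T' [qpT' trT']]]]].
move=> /right_equiv_eqv eT'.
have rr := @rho_rhom K V I.
have [lfT pT _] := qpT; have [lfT' pT' _] := qpT'.
have [_ pN _] := qpN; have [_ pM _] := qpM.
have pM' : potential (qpot (restriction I M)) by exact: rhom_potential.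
apply: eqv_right_equiv => //.
apply: (@eqv_reduced_part _ _ T N (restriction I T') (restriction I M)) => //.
- by move=> b; exact: (lfT' (val b)).
- exact: trivial_nondeg.
- exact/nondeg_quad_restriction/trivial_nondeg.
- exact: rhom_potential.
- exact: reduced_mpow3.
- exact: (rhom_mpow (@rr _)) (reduced_mpow3 qpM redM).
(* The chain: T + N, the premutation of the restriction, the restriction of the premutation, the
   restriction of T' + M, the sum of the restrictions. *)
apply: eqv_trans (eqv_sym eT) _.
apply: eqv_trans (eqv_sym (eqv_restriction_sum I T' M)).
apply: eqv_trans (eqv_restriction I eT').
apply: eqv_premutation_restriction => //.
have h1 := cyc_equiv_commc eS1.
have h2 := rhom_commc (@rr _) (cyc_equiv_commc eS2).
(* Both representatives are compared with the restriction of the original potential. *)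
rewrite -opprB; apply: commcN.
rewrite -(subrK (qpot (restriction I P)) (alg_ext _ _)) -addrA.
apply: commcD => //; rewrite -opprB -(rhomB (@rr _)); exact: commcN.
Qed.
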